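(* Let $n \geq 4$ and let $G$ be an upper semicontinuous decomposition of $\mathbb{R}^n$ into convex sets. Then the quotient space $\mathbb{R}^n/G$ has the disjoint arc-disk property.
   Context: A decomposition $G$ of a space $M$ is a partition of $M$ into (nonempty, pairwise disjoint) subsets. $M/G$ denotes the decomposition space, i.e. the set of elements of $G$ with the quotient topology, and $\pi: M \to M/G$ is the decomposition (quotient) map. A map $f: X \to Y$ is proper if $f^{-1}(C)$ is compact for every compact $C \subset Y$. A decomposition $G$ of $M$ into compact sets is upper semicontinuous if and only if the decomposition map $\pi: M \to M/G$ is proper; in particular, the elements of an upper semicontinuous decomposition are compact. ''Into convex sets'' means that each element of $G$ is a convex subset of $\mathbb{R}^n$. For such $G$ the space $\mathbb{R}^n/G$ is metrizable. A metrizable space $X$ has the disjoint arc-disk property (DADP) if any two maps $\alpha: I \to X$ and $f: D^2 \to X$ can be approximated by maps with disjoint images, where $I$ is the unit interval and $D^2$ is a (closed 2-dimensional) disk. That is, fixing a metric $d$ compatible with the topology of $X$: for all continuous $\alpha: I \to X$ and $f: D^2 \to X$ and every $\varepsilon > 0$ there exist continuous $\alpha': I \to X$ and $f': D^2 \to X$ with $d(\alpha(t),\alpha'(t)) < \varepsilon$ for all $t \in I$, $d(f(x),f'(x)) < \varepsilon$ for all $x \in D^2$, and $\alpha'(I) \cap f'(D^2) = \emptyset$. (By compactness of $I$ and $D^2$, this does not depend on the choice of compatible metric $d$.) *)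

(* Defs.v *)
From HB Require Import structures.
From mathcomp Require Import all_boot all_order all_algebra.
From mathcomp Require Import all_classical all_reals all_analysis.

Set Implicit Arguments.
Unset Strict Implicit.
Unset Printing Implicit Defensive.

Import Order.TTheory GRing.Theory Num.Theory.
Import numFieldNormedType.Exports.

Local Open Scope classical_set_scope.
Local Open Scope ring_scope.

(* [partition] is about an indexed family: here, [elements] indexed by itself. *)
Record decomposition (M : Type) := Decomposition {
  elements : set (set M);
  elements_partition : partition elements id [set: M] }.

Section decomposition_space.
Variables (M : Type) (G : decomposition M).

Definition decomposition_elements : Type := {g : set M | elements G g}.

Lemma element_of (x : M) : exists g : decomposition_elements, sval g x.
Proof.
have [cG _ _] := elements_partition G.
have [g Gg gx] : cover (elements G) id x by rewrite cG.
exact: (ex_intro _ (exist _ g Gg) gx).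
Qed.

Lemma element_nonempty (g : decomposition_elements) : exists x, sval g x.
Proof. by have [_ _] := elements_partition G; apply; exact: svalP. Qed.

Definition decomposition_pi (x : M) : decomposition_elements :=
  sval (cid (element_of x)).

Definition decomposition_repr (g : decomposition_elements) : M :=
  sval (cid (element_nonempty g)).

Lemma decomposition_reprK : cancel decomposition_repr decomposition_pi.
Proof.
move=> g; have gr := svalP (cid (element_nonempty g)).
have pr := svalP (cid (element_of (decomposition_repr g))).
have [_ tG _] := elements_partition G.
apply: eq_sig_hprop => [h|]; first exact: Prop_irrelevance.
apply: tG; [exact: svalP|exact: svalP|].
by exists (decomposition_repr g); split.
Qed.

HB.instance Definition _ :=
  isQuotient.Build M decomposition_elements decomposition_reprK.

Lemma decomposition_piP (x : M) : sval (\pi_decomposition_elements%qT x) x.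
Proof. by rewrite unlock; exact: (svalP (cid (element_of x))). Qed.

End decomposition_space.

Definition decomposition_space (M : topologicalType) (G : decomposition M) :
    topologicalType :=
  quotient_topology (decomposition_elements G).

Definition decomposition_map (M : topologicalType) (G : decomposition M) :
    M -> decomposition_space G :=
  \pi_(quotient_topology (decomposition_elements G))%qT.

Definition proper_map (X Y : topologicalType) (f : X -> Y) :=
  forall C : set Y, compact C -> compact (f @^-1` C).

(* Upper semicontinuity of a decomposition into compact sets, expressed as
   properness of the decomposition map. *)
Definition upper_semicontinuous (M : topologicalType) (G : decomposition M) :=
  (forall g, elements G g -> compact g) /\ proper_map (@decomposition_map M G).

Section disjoint_arc_disk.
Variables (R : realType) (X : topologicalType).

Definition compatible_metric (d : X -> X -> R) :=
  [/\ forall x y, 0 <= d x y,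
      forall x y, d x y = 0 <-> x = y,
      forall x y, d x y = d y x,
      forall x y z, d x z <= d x y + d y z &
      forall (x : X) (A : set X),
        nbhs x A <-> exists2 e : R, 0 < e & [set y | d x y < e] `<=` A].

Definition metrizable := exists d : X -> X -> R, compatible_metric d.

Definition unit_disk : set (R * R) := [set x | x.1 ^+ 2 + x.2 ^+ 2 <= 1].

(* Maps of the arc and the disk into X are total functions on R and R * R of
   which only the restriction to `[0, 1] and unit_disk matters. *)
Definition disjoint_arc_disk_for (d : X -> X -> R) :=
  forall (a : R -> X) (f : R * R -> X) (e : R),
    {within `[0, 1], continuous a} -> {within unit_disk, continuous f} ->
    0 < e ->
    exists (a' : R -> X) (f' : R * R -> X),
      [/\ {within `[0, 1], continuous a'}, {within unit_disk, continuous f'},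
          forall t, t \in `[0, 1] -> d (a t) (a' t) < e,
          forall x, unit_disk x -> d (f x) (f' x) < e &
          (a' @` `[0, 1]%classic) `&` (f' @` unit_disk) = set0].

(* By compactness the second condition holds for one compatible metric iff it
   holds for all; the first one keeps it from being vacuous. *)
Definition disjoint_arc_disk_property :=
  metrizable /\
  forall d : X -> X -> R, compatible_metric d -> disjoint_arc_disk_for d.

End disjoint_arc_disk.

Arguments metrizable : clear implicits.
Arguments disjoint_arc_disk_property : clear implicits.

(* Main.v *)
Require Import Defs.
From HB Require Import structures.
From mathcomp Require Import all_boot all_order all_algebra.
From mathcomp Require Import zify ring lra.

(** Approximate both maps by maps into R^n that are piecewise affine on fine
    grids: if the vertices lie in elements close to a given element g, they lie
    in a thin convex neighbourhood of g, and so do their convex combinations.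
    The disk thus goes into finitely many triangles, and it suffices to push an
    arc off the image of one triangle s at a time.

    Let K be the saturation of s. Since the elements are convex, K can be
    deformed along almost-elements to s, by straight lines from x to r x, where
    r is a continuous approximate selection of (element of x) /\ s. Hence K has
    no saturated interior, and if a segment [a, b] in a saturated open set U
    misses s, and a and b are off K, then a and b can be joined in U \ K:
    otherwise, with W the path component of a, the maps x - a and x - b would be
    homotopic without zeros on K and off U (deform x to r x, move a to b along
    the segment, deform back), and since x - b has no zero in W, a map without
    zeros that equals x - a off W would exist, against Brouwer's theorem. As
    n >= 4, consecutive vertices of the arc can be chosen such that the
    segments between them miss the two-dimensional s.

    Brouwer's theorem itself comes from a cubical cup product modulo 2. *)

Set Implicit Arguments.
Unset Strict Implicit.
Unset Printing Implicit Defensive.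

Import Order.TTheory GRing.Theory Num.Theory.

Local Open Scope ring_scope.

(** * Cubical cup products *)

Lemma addrrF2 (x : 'F_2) : x + x = 0.
Proof. by apply: addrr_pchar2; exact: pchar_Fp. Qed.

Lemma opprF2 (x : 'F_2) : - x = x.
Proof. by apply/esym/eqP; rewrite -addr_eq0 addrrF2. Qed.

(** Off-diagonal terms come in equal pairs, which cancel modulo 2. *)
Lemma sum_sym_F2 n (D : {set 'I_n}) (s : 'I_n -> 'I_n -> 'F_2) :
  (forall i j, s i j = s j i) ->
  \sum_(i in D) \sum_(j in D :\ i) s i j = 0.
Proof.
move=> s_sym; have E i : \sum_(j in D :\ i) s i j =
    \sum_(j in D | (i < j)%N) s i j + \sum_(j in D | (j < i)%N) s i j.
  rewrite (bigID (fun j : 'I_n => (i < j)%N)) /=; congr (_ + _); apply: eq_bigl => j;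
  by rewrite !inE -val_eqE /=; case: ltngtP => //=; rewrite ?andbF ?andbT.
rewrite (eq_bigr _ (fun i _ => E i)) big_split /=.
rewrite [X in _ + X](exchange_big_dep (mem D)) //= => [|i j iD /andP[] //].
rewrite -[RHS](addrrF2 (\sum_(i in D) \sum_(j in D | (i < j)%N) s i j)).
congr (_ + _); apply: eq_bigr => i iD.
apply: eq_big => [j|j _]; last exact: s_sym.
by rewrite iD /= andbC andbC; case: (j \in D); rewrite ?andbT ?andbF.
Qed.

Section cubical_cup_product.
Variables n m : nat.
Implicit Types (v w : {ffun 'I_n -> 'I_m.+1}) (D E : {set 'I_n}) (i j : 'I_n).

(** [ordS] wraps around, so moving up in fixed directions is a bijection of the grid and sums can be
    reindexed by it. The vertices of the cube at [v] with directions [D] are the [up v E] with [E]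
    inside [D]. *)
Definition up v D := [ffun i => if i \in D then ordS (v i) else v i].

Lemma upU v D E : [disjoint D & E] -> up (up v D) E = up v (D :|: E).
Proof.
move=> DE; apply/ffunP => i; rewrite !ffunE inE.
case: (boolP (i \in E)) => iE; last by rewrite orbF.
by rewrite (disjointFl DE iE) orbT.
Qed.

Lemma up1 v D j : j \in D -> up (up v [set j]) (D :\ j) = up v D.
Proof.
move=> jD; rewrite upU ?setD1K //.
by rewrite disjoints1 !inE eqxx.
Qed.

Variable A : nat -> {ffun 'I_n -> 'I_m.+1} -> 'F_2.

(* The cup product over F_2 of the coboundaries of A 0, ..., A (k - 1),
   evaluated on the cube with lowest vertex v and directions D. *)
Fixpoint cup k v D : 'F_2 :=
  if k is k'.+1 then
    \sum_(j in D) cup k' v (D :\ j) * (A k' (up v D) + A k' (up v (D :\ j)))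
  else (D == set0)%:R.

(** The cocycle identity: a product of coboundaries takes the same sum on the upper as on the lower
    faces of a cube. Rewriting the upper faces by induction and adding the lower ones leaves a
    double sum over [i != j] in [D] that is symmetric, hence zero. *)
Lemma cup_closed k v D :
  \sum_(j in D) cup k (up v [set j]) (D :\ j) = \sum_(j in D) cup k v (D :\ j).
Proof.
elim: k v D => [//|k IHk] v D.
suff : \sum_(j in D) cup k.+1 (up v [set j]) (D :\ j)
     + \sum_(j in D) cup k.+1 v (D :\ j) = 0.
  by move/eqP; rewrite addr_eq0 opprF2 => /eqP.
have H1 : \sum_(j in D) cup k.+1 (up v [set j]) (D :\ j) =
    \sum_(i in D) \sum_(j in D :\ i) cup k v (D :\ i :\ j) *
       (A k (up v D) + A k (up v (D :\ i))).
  transitivity (\sum_(j in D) \sum_(i in D :\ j) cup k (up v [set j]) (D :\ j :\ i)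
     * (A k (up v D) + A k (up v (D :\ i)))).
    apply: eq_bigr => j jD /=; apply: eq_bigr => i; rewrite !inE => /andP[ij iD].
    have -> : up (up v [set j]) (D :\ j :\ i) = up v (D :\ i).
      by rewrite setDDl setUC -setDDl up1 // !inE jD andbT eq_sym.
    by rewrite up1.
  rewrite (exchange_big_dep (mem D)) /= => [|i j _]; last by rewrite inE => /andP[].
  apply: eq_bigr => i iD.
  transitivity ((\sum_(j in D :\ i) cup k (up v [set j]) (D :\ i :\ j))
     * (A k (up v D) + A k (up v (D :\ i)))).
    rewrite big_distrl /=; apply: eq_big => [j|j _].
      by rewrite !inE iD andbT eq_sym andbC.
    by rewrite setDDl setUC -setDDl.
  by rewrite IHk big_distrl.
rewrite H1 -big_split /=.
rewrite -[RHS](@sum_sym_F2 _ D (fun i j => cup k v (D :\ i :\ j) *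
   (A k (up v D) + A k (up v (D :\ i :\ j))))); last first.
  by move=> i j; rewrite [D :\ i :\ j]setDDl setUC -setDDl.
apply: eq_bigr => i iD; rewrite -big_split /=; apply: eq_bigr => j jD.
by rewrite -mulrDr addrA -[_ + _ + A k (up v (D :\ i))]addrA addrrF2 addr0.
Qed.

(** Each summand of the product has one coboundary factor for every [l < k], and a nonzero factor
    says that [A l] takes two values on the cube. *)
Lemma cup_pos k v D : cup k v D != 0 ->
  forall l, (l < k)%N -> exists E E', A l (up v E) != A l (up v E').
Proof.
elim: k D => [//|k IHk] D /= nz.
have [j] : exists j, (cup k v (D :\ j) != 0) && (A k (up v D) + A k (up v (D :\ j)) != 0).
  apply/existsP; apply: contraNT nz; rewrite negb_exists => /forallP nz.
  apply/eqP; rewrite big1 // => j _; apply/eqP; rewrite mulf_eq0.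
  by have := nz j; rewrite negb_and !negbK.
move=> /andP[/IHk{}IHk nzA] l; rewrite ltnS leq_eqVlt => /predU1P[->|/IHk//].
exists D, (D :\ j); apply: contra nzA => /eqP ->; by rewrite addrrF2.
Qed.

Hypothesis A0 : forall i v, v i = ord0 -> A i v = 0.
Hypothesis A1 : forall i v, v i = ord_max -> A i v = 1.

(** [A j] is constant on a cube inside a face of the grid orthogonal to [j], so its coboundary there
    is zero. *)
Lemma cup_face k v E j : (j < k)%N -> j \notin E ->
  (v j == ord0) || (v j == ord_max) -> cup k v E = 0.
Proof.
elim: k E => [//|k IHk] E; rewrite ltnS leq_eqVlt => jk jE vj /=.
apply: big1 => i iE; case/predU1P: jk => [<-|jk]; last first.
  by rewrite IHk ?mul0r // inE negb_and jE orbT.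
have fj D : j \notin D -> up v D j = v j by move=> jD; rewrite ffunE (negPf jD).
have jEi : j \notin E :\ i by rewrite inE negb_and jE orbT.
by case/orP: vj => /eqP vj; [rewrite !(A0 (i := j)) ?fj //|rewrite !(A1 (i := j)) ?fj //];
  rewrite addrrF2 mulr0.
Qed.

(** Vertices in [box k], with directions [low k], enumerate the small cubes of the k-dimensional
    face on which the coordinates from [k] on are maximal; no such cube wraps around. *)
Let low k := [set i : 'I_n | (i < k)%N].
Let box k v := [forall i : 'I_n, (v i != ord_max) == (i < k)%N].

(** Telescoping in direction [j]: modulo 2, interior values occur twice and only both ends
    remain. *)
Lemma reindex_up j (P : pred {ffun 'I_n -> 'I_m.+1}) (F : {ffun 'I_n -> 'I_m.+1} -> 'F_2) :
  (forall v, P (up v [set j]) = P v) ->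
  \sum_(v | P v && (v j != ord_max)) F (up v [set j]) +
  \sum_(v | P v && (v j != ord_max)) F v =
  \sum_(v | P v && (v j == ord0)) F v + \sum_(v | P v && (v j == ord_max)) F v.
Proof.
move=> PE.
pose dn v := [ffun i => if i == j then ord_pred (v i) else v i].
have upK : cancel (up^~ [set j]) dn.
  move=> v; apply/ffunP => i; rewrite !ffunE inE.
  by case: eqP => // _; rewrite ordSK.
have dnK : cancel dn (up^~ [set j]).
  move=> v; apply/ffunP => i; rewrite !ffunE inE.
  by case: eqP => // _; rewrite ord_predK.
have -> : \sum_(v | P v && (v j != ord_max)) F (up v [set j]) =
    \sum_(v | P v && (v j != ord0)) F v.
  rewrite [RHS](reindex (up^~ [set j])) /=; last by exists dn => v _.
  apply: eq_bigl => v; rewrite PE ffunE inE eqxx; congr (_ && ~~ _).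
  rewrite -!val_eqE /=; have := ltn_ord (v j); rewrite ltnS leq_eqVlt.
  case/predU1P => [->|lt_vm]; first by rewrite modnn !eqxx.
  by rewrite modn_small ?ltnS // ltn_eqF.
have split0 := bigID (fun v => v j == ord0) P F.
have splitm := bigID (fun v => v j == ord_max) P F.
apply/eqP; rewrite -subr_eq0 opprF2; apply/eqP; transitivity ((\sum_(v | P v && (v j == ord0)) F v +
  \sum_(v | P v && (v j != ord0)) F v) + (\sum_(v | P v && (v j == ord_max)) F v +
  \sum_(v | P v && (v j != ord_max)) F v)); first by ring.
by rewrite -split0 -splitm addrrF2.
Qed.

(** Discrete Stokes theorem, by induction on the dimension of the face: the sum over its small cubes
    reduces to the sum over one boundary face. *)
Lemma sum_cup k : (k <= n)%N -> \sum_(v | box k v) cup k v (low k) = 1.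
Proof.
elim: k => [|k IHk] kn.
  have low0 : low 0 = set0 by apply/setP => i; rewrite !inE.
  rewrite (big_pred1 [ffun=> ord_max]) ?low0 /= ?eqxx // => v.
  apply/forallP/eqP => [vE|-> i]; last by rewrite ffunE eqxx.
  by apply/ffunP => i; rewrite ffunE; have /eqP/negbT := vE i; rewrite negbK => /eqP.
pose kk := Ordinal kn.
(* Since [cup k] is closed, [cup k.+1] is the coboundary of [eta]. *)
pose eta v D := cup k v D * A k (up v D).
have cupE v D : cup k.+1 v D =
    \sum_(j in D) (eta (up v [set j]) (D :\ j) + eta v (D :\ j)).
  rewrite /= (eq_bigr (fun j => cup k v (D :\ j) * A k (up v D) + eta v (D :\ j)));
    last by move=> j _; rewrite mulrDr.
  rewrite !big_split /=; congr (_ + _).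
  rewrite -big_distrl /= -cup_closed big_distrl /=.
  by apply: eq_bigr => j jD; rewrite /eta up1.
rewrite (eq_bigr _ (fun v _ => cupE v _)) exchange_big /=.
(* The condition on coordinate [j] is split off, so that what remains is invariant under moving up
   in direction [j]. *)
pose boxj j v := [forall i : 'I_n, (i != j) ==> ((v i != ord_max) == (i < k.+1)%N)].
have boxE j v : j \in low k.+1 -> box k.+1 v = boxj j v && (v j != ord_max).
  rewrite inE => jk; apply/forallP/andP => [vE|[/forallP vE vj] i].
    split; last by have := vE j; rewrite jk => /eqP ->.
    by apply/forallP => i; apply/implyP => _; exact: vE.
  have [->|ij] := eqVneq i j; first by rewrite vj jk.
  by have := vE i; rewrite ij.
have boxjP j v : boxj j (up v [set j]) = boxj j v.
  apply: eq_forallb => i; rewrite ffunE inE.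
  by case: (i =P j).
rewrite (eq_bigr (fun j => \sum_(v | boxj j v && (v j == ord0)) eta v (low k.+1 :\ j)
    + \sum_(v | boxj j v && (v j == ord_max)) eta v (low k.+1 :\ j))); last first.
  move=> j jk; rewrite (eq_bigl _ _ (fun v => boxE j v jk)) big_split /=.
  exact: (reindex_up (fun v => eta v (low k.+1 :\ j)) (boxjP j)).
(* Faces orthogonal to [j < k] contribute nothing by [cup_face]. Orthogonally to [kk], the lower
   face has [A k = 0], and the upper one has [A k = 1], which gives the sum for [k]. *)
rewrite (bigD1 kk) /=; last by rewrite inE.
rewrite [X in _ + X]big1 ?addr0; last first.
  move=> j; rewrite inE ltnS leq_eqVlt => /andP[/orP[jk /eqP[]|jk _]].
    by apply/val_inj/eqP.
  rewrite !big1 ?addr0 // => v /andP[_ vj]; rewrite /eta (@cup_face k _ _ j) ?mul0r ?vj ?orbT //;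
  by rewrite !inE eqxx.
have lowE : low k.+1 :\ kk = low k.
  by apply/setP => i; rewrite !inE -val_eqE /=; lia.
have upk v : up v (low k) kk = v kk by rewrite ffunE inE /= ltnn.
rewrite lowE big1 ?add0r => [|v /andP[_ /eqP vk]]; last first.
  by rewrite /eta (A0 (i := kk)) ?mulr0 // upk.
rewrite -[RHS](IHk (ltnW kn)); apply: eq_big => v.
  apply/andP/forallP => [[/forallP vE /eqP vk] i|vE].
    have [->|ik] := eqVneq i kk; first by rewrite vk eqxx ltnn.
    have := vE i; rewrite ik /= => /eqP ->; move: ik; rewrite -val_eqE /= => ik.
    by apply/eqP; lia.
  split; last by have /eqP := vE kk; rewrite ltnn => /negbT; rewrite negbK.
  apply/forallP => i; apply/implyP => ik; have /eqP -> := vE i.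
  by move: ik; rewrite -val_eqE /= => ik; apply/eqP; lia.
by move=> /andP[_ /eqP vk]; rewrite /eta (A1 (i := kk)) ?mulr1 // upk.
Qed.

End cubical_cup_product.

(** A combinatorial form of Brouwer's theorem: if the i-th labelling separates the i-th pair of
    opposite faces, some small cube sees both values of every labelling. The cup products over all
    small cubes add up to 1, so one of them is nonzero. *)
Lemma cube_labelling n m (A : 'I_n -> {ffun 'I_n -> 'I_m.+1} -> bool) :
  (forall i (v : {ffun 'I_n -> 'I_m.+1}), v i = ord0 -> A i v = false) ->
  (forall i (v : {ffun 'I_n -> 'I_m.+1}), v i = ord_max -> A i v = true) ->
  exists v : {ffun 'I_n -> 'I_m.+1}, (forall i, v i != ord_max) /\
    forall i, exists D E, A i (up v D) && ~~ A i (up v E).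
Proof.
move=> A0 A1.
pose B k (v : {ffun 'I_n -> 'I_m.+1}) : 'F_2 := if insub k is Some i then (A i v)%:R else 0.
have BE (i : 'I_n) (v : {ffun 'I_n -> 'I_m.+1}) : B i v = (A i v)%:R by rewrite /B valK.
have B0 i (v : {ffun 'I_n -> 'I_m.+1}) : v i = ord0 -> B i v = 0 by move=> vi; rewrite BE A0.
have B1 i (v : {ffun 'I_n -> 'I_m.+1}) : v i = ord_max -> B i v = 1 by move=> vi; rewrite BE A1.
have := sum_cup B0 B1 (leqnn n).
set low := [set i : 'I_n | _]; set S := \sum_(v | _) _ => S1.
have [v /andP[vbox cupv]] : exists v : {ffun 'I_n -> 'I_m.+1},
    [forall i : 'I_n, (v i != ord_max) == (i < n)%N] && (cup B n v low != 0).
  apply/existsP; apply: contraT; rewrite negb_exists => /forallP nz.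
  have : S = 0.
    rewrite /S big1 // => v vbox; apply/eqP; have := nz v.
    by rewrite vbox /= negbK.
  by rewrite S1 => /eqP; rewrite oner_eq0.
exists v; split=> [i|i]; first by move/forallP: vbox => /(_ i); rewrite ltn_ord => /eqP.
have [D [E]] := cup_pos cupv (ltn_ord i); rewrite !BE => DE.
case AD: (A i (up v D)) DE; case AE: (A i (up v E)); rewrite ?eqxx // => _.
  by exists D, E; rewrite AD AE.
by exists E, D; rewrite AD AE.
Qed.

From mathcomp Require Import all_classical all_reals all_analysis.
Import numFieldNormedType.Exports.
Local Open Scope classical_set_scope.

(** * Continuity and compactness *)

Section continuity.
Variables (R : realType) (T : topologicalType) (V : normedModType R).
Implicit Types (f g : T -> V) (s t : T -> R).

Lemma contD f g : continuous f -> continuous g -> continuous (fun x => f x + g x).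
Proof. by move=> cf cg x; exact: continuousD (cf x) (cg x). Qed.

Lemma contB f g : continuous f -> continuous g -> continuous (fun x => f x - g x).
Proof. by move=> cf cg x; exact: continuousB (cf x) (cg x). Qed.

Lemma contZ s f : continuous s -> continuous f -> continuous (fun x => s x *: f x).
Proof. by move=> cs cf x; exact: continuousZ (cs x) (cf x). Qed.

Lemma contM s t : continuous s -> continuous t -> continuous (fun x => s x * t x).
Proof. by move=> cs ct x; exact: continuousM (cs x) (ct x). Qed.

Lemma contV s : (forall x, s x != 0) -> continuous s -> continuous (fun x => (s x)^-1).
Proof. by move=> s0 cs x; apply: continuousV; [exact: s0|exact: cs]. Qed.

Lemma cont_norm f : continuous f -> continuous (fun x => `|f x|).
Proof. by move=> cf x; apply: continuous_comp; [exact: cf|exact: norm_continuous]. Qed.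

Lemma cont_min s t : continuous s -> continuous t -> continuous (fun x => Num.min (s x) (t x)).
Proof. by move=> cs ct x; exact: continuous_min (cs x) (ct x). Qed.

Lemma cont_max s t : continuous s -> continuous t -> continuous (fun x => Num.max (s x) (t x)).
Proof. by move=> cs ct x; exact: continuous_max (cs x) (ct x). Qed.

Lemma cont_sum (I : Type) (r : seq I) (P : pred I) (F : I -> T -> V) :
  (forall i, continuous (F i)) -> continuous (fun x => \sum_(i <- r | P i) F i x).
Proof.
move=> cF; elim: r => [|i r IHr] x.
  by under eq_fun do rewrite big_nil; exact: cst_continuous.
under eq_fun do rewrite big_cons; case: (P i); last exact: IHr.
by apply: continuousD; [exact: cF|exact: IHr].
Qed.

End continuity.

Lemma cont_id (T : topologicalType) : continuous (fun x : T => x).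
Proof. by move=> x; exact: cvg_id. Qed.

Lemma cont_comp (S T U : topologicalType) (f : S -> T) (g : T -> U) :
  continuous f -> continuous g -> continuous (g \o f).
Proof. by move=> cf cg x; apply: continuous_comp; [exact: cf|exact: cg]. Qed.

Lemma cont_pair (S T U : topologicalType) (f : S -> T) (g : S -> U) :
  continuous f -> continuous g -> continuous (fun x => (f x, g x)).
Proof.
move=> cf cg x A [[B C] [/= fB gC] BCA].
have Bx : nbhs x (f @^-1` B) by exact: (cf x).
have Cx : nbhs x (g @^-1` C) by exact: (cg x).
suff : nbhs x ((fun y => (f y, g y)) @^-1` A) by [].
by apply: filterS2 Bx Cx => y By Cy; exact: (BCA (f y, g y)).
Qed.

Lemma norm_compatible_metric (R : realType) (V : normedModType R) :
  compatible_metric (fun x y : V => `|x - y|).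
Proof.
split=> [x y|x y|x y|x y z|x A]; first exact: normr_ge0.
- by split=> [/eqP|->]; rewrite ?subrr ?normr0 // normr_eq0 subr_eq0 => /eqP.
- exact: distrC.
- by rewrite -[x - z](subrKA y) ler_normD.
- rewrite -nbhs_ballE; split=> -[e e0 eA]; exists e => //; move: eA;
  by rewrite -ball_normE.
Qed.

Section metric.
Variables (R : realType) (T : topologicalType) (d : T -> T -> R).
Hypothesis dT : compatible_metric d.

(** If the [e]-ball at [x] lies in a member of [F], then radius [e / 2] serves all points within
    [e / 2] of [x]; compactness makes the radius uniform. *)
Lemma lebesgue_number (K : set T) (F : set (set T)) :
  compact K -> (forall x, K x -> exists2 U, F U & nbhs x U) ->
  exists2 e : R, 0 < e & forall x, K x -> exists2 U, F U & [set y | d x y < e] `<=` U.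
Proof.
have [d0 dE dC dD dn] := dT.
move=> /compact_near_coveringP/(_ R 0^'+
  (fun e x => exists2 U, F U & [set y | d x y < e] `<=` U)) cK FK.
have [|e /= e0 eK] := cK _.
  move=> x /FK[U FU /dn[e e0 eU]].
  have e20 : 0 < e / 2 by rewrite divr_gt0.
  exists ([set y | d x y < e / 2], [set r | r < e / 2]).
    split=> /=; first by apply/dn; exists (e / 2).
    exact: nbhs_right_lt.
  move=> [y r] /= [xy re]; exists U => // z yz; apply: eU => /=.
  by rewrite (le_lt_trans (dD _ y _))// [e]splitr ltrD// (lt_trans yz).
exists (e / 2); first by rewrite divr_gt0.
move=> x Kx; apply: (eK (e / 2)) => //=; last by rewrite divr_gt0.
by rewrite sub0r normrN gtr0_norm ?divr_gt0 // ltr_pdivrMr // ltr_pMr // ltr1n.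
Qed.

Lemma compact_ball_sub (K U : set T) : compact K -> open U -> K `<=` U ->
  exists2 e : R, 0 < e & forall x, K x -> [set y | d x y < e] `<=` U.
Proof.
move=> cK oU KU; have [|e e0 eK] := @lebesgue_number K [set U] cK.
  by move=> x /KU Ux; exists U => //; exact: open_nbhs_nbhs.
by exists e => // x /eK[_ ->].
Qed.

End metric.

(** The tube lemma: projection along a compact factor is a closed map. *)
Lemma closed_proj (S T : topologicalType) (K : set S) (C : set (T * S)) :
  compact K -> closed C -> closed [set x | exists2 s, K s & C (x, s)].
Proof.
move=> /compact_near_coveringP cK cC.
rewrite -openC openE => x /= Cx.
have nC : \forall y \near x, K `<=` (fun s => ~ C (y, s)).
  apply: (cK T (nbhs x) (fun y s => ~ C (y, s))) => s Ks.
  have : nbhs (x, s) (~` C).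
    by apply: open_nbhs_nbhs; split; [exact: closed_openC|move=> Cxs; apply: Cx; exists s].
  by move=> [[A B] /= [xA sB] AB]; exists (B, A) => // -[z y] [/= Bz Ay]; exact: (AB (y, z)).
by move: nC; apply: filterS => y yC [s Ks]; exact: yC.
Qed.

Lemma cont_coord (R : realType) n (i : 'I_n) : continuous (fun x : 'rV[R]_n => x ord0 i).
Proof. exact: coord_continuous. Qed.

Lemma rV_norm_ltP (R : realType) n (x : 'rV[R]_n) e : 0 < e ->
  (forall i, `|x ord0 i| < e) -> `|x| < e.
Proof.
move=> e0 xe; rewrite [ltLHS]/Num.norm /= mx_normrE; apply/bigmax_ltP; split=> // -[i j] _ /=.
by rewrite ord1.
Qed.

Lemma rV_norm_coord (R : realType) n (x : 'rV[R]_n) i : `|x ord0 i| <= `|x|.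
Proof.
by rewrite [leRHS]/Num.norm /= mx_normrE; apply/(bigmax_geP _ _ _ _); right; exists (ord0, i).
Qed.

(* A form of Brouwer's theorem: a map of R^n without zeros cannot agree with a
   translation near infinity. *)
Lemma translation_at_infinity_zero (R : realType) n (E : 'rV[R]_n -> 'rV[R]_n) a M :
  continuous E -> (forall x, M <= `|x| -> E x = x - a) -> exists x, E x = 0.
Proof.
move=> cE EM; apply: contrapT => /forallNP noz.
(* The cube of half-side [L] has [a] in its interior, and its boundary lies where [E] is the
   translation. *)
pose L := `|M| + `|a| + 1.
have L0 : 0 < L by rewrite /L; have := normr_ge0 M; have := normr_ge0 a; lra.
pose cube := [set x : 'rV[R]_n | forall i, `[-L, L]%classic (x ord0 i)].
have ccube : compact cube by apply: (@rV_compact _ _ (fun=> `[- L, L]%classic)) => _; exact: segment_compact.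
have cEi i : continuous (fun x => E x ord0 i).
  exact: (cont_comp cE (@cont_coord R n i)).
(* Sets on which some coordinate of [E] keeps a strict sign; without zeros of [E] they cover the
   cube. The grid below is finer than their Lebesgue number. *)
pose F := [set U | exists i, (forall y, U y -> 0 < E y ord0 i) \/
                             (forall y, U y -> E y ord0 i < 0)].
have [|e e0 eF] := lebesgue_number (norm_compatible_metric 'rV[R]_n) (F := F) ccube.
  move=> x _; have [i Exi] : exists i, E x ord0 i != 0.
    apply: contrapT => /forallNP Ex0; apply: (noz x); apply/rowP => i; rewrite mxE.
    by apply/eqP; have /negP := Ex0 i; rewrite negbK.
  have [Exn|Exp|/eqP] := ltgtP (E x ord0 i) 0; last by rewrite (negPf Exi).
  - exists ((fun y => E y ord0 i) @^-1` [set z | z < 0]); first by exists i; right.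
    exact: cEi (lt_nbhsl Exn).
  - exists ((fun y => E y ord0 i) @^-1` [set z | 0 < z]); first by exists i; left.
    exact: cEi (lt_nbhsr Exp).
have [m [m0 mL]] : exists m, (0 < m)%N /\ 2 * L / m%:R < e.
  have Le0 : 0 <= 2 * L / e by apply: divr_ge0; lra.
  exists (Num.bound (2 * L / e)).+1; split=> //.
  rewrite ltr_pdivrMr ?ltr0Sn // [e * _]mulrC -ltr_pdivrMr //.
  by rewrite (lt_trans (archi_boundP Le0)) // ltr_nat.
have mR0 : (0 : R) < m%:R by rewrite ltr0n.
pose pt (v : {ffun 'I_n -> 'I_m.+1}) : 'rV[R]_n := \row_i (- L + 2 * L / m%:R * (v i)%:R).
have ptL v i : - L <= pt v ord0 i <= L.
  rewrite mxE lerDl; apply/andP; split; first by rewrite mulr_ge0 // divr_ge0 //; lra.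
  suff : 2 * L / m%:R * (v i)%:R <= 2 * L by lra.
  rewrite -[2 * L / _ * _]mulrA ler_piMr //; first by lra.
  by rewrite mulrC ler_pdivrMr // mul1r ler_nat -ltnS.
have ptE v i : `|pt v ord0 i| = L -> E (pt v) ord0 i = pt v ord0 i - a ord0 i.
  move=> ptL1; rewrite EM ?mxE // (le_trans _ (rV_norm_coord _ i)) // ptL1 /L.
  by have := ler_norm M; have := normr_ge0 a; lra.
have aL i : - L < a ord0 i < L.
  rewrite -ltr_norml (le_lt_trans (rV_norm_coord _ _)) // /L.
  by have := normr_ge0 M; lra.
(* Labelling by the signs of the coordinates of [E], which on opposite faces are those of [x - a].
   The small cube found lies in a member of [F] and yet sees both labels in every coordinate. *)
have [||v [vm vDE]] := @cube_labelling n m (fun i v => 0 < E (pt v) ord0 i).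
- move=> i v vi; have pti : pt v ord0 i = - L by rewrite mxE vi mulr0 addr0.
  rewrite ptE pti ?normrN ?gtr0_norm //; apply/negbTE; rewrite -leNgt.
  by have := aL i; lra.
- move=> i v vi; have pti : pt v ord0 i = L by rewrite mxE vi /= divfK ?gt_eqF //; ring.
  by rewrite ptE pti ?gtr0_norm //; have := aL i; lra.
have [|U [i UE] eU] := eF (pt v); first by move=> i /=; rewrite in_itv /= ptL.
have upe D : U (pt (up v D)).
  apply: eU => /=; apply: rV_norm_ltP => // j; rewrite !mxE ffunE.
  case: ifP => _; last by rewrite subrr normr0.
  have -> : (ordS (v j) : nat) = (v j).+1.
    rewrite /= modn_small // ltnS ltn_neqAle -ltnS ltn_ord andbT.
    by have := vm j; rewrite -val_eqE.
  have -> : - L + 2 * L / m%:R * (v j)%:R - (- L + 2 * L / m%:R * (v j).+1%:R) = - (2 * L / m%:R).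
    by rewrite -natr1; ring.
  by rewrite normrN gtr0_norm // divr_gt0 // mulr_gt0.
have [D [D' /andP[ED ED']]] := vDE i.
case: UE => UE; first by rewrite UE ?upe in ED'.
by move: ED; rewrite lt_gtF // UE ?upe.
Qed.

(** * Metrizability of the quotient *)

Lemma ex_invnS_lt (R : realType) (e : R) : 0 < e -> exists k : nat, k.+1%:R^-1 < e.
Proof.
move=> e0; have e10 : 0 <= e^-1 by rewrite invr_ge0 ltW.
exists (Num.bound e^-1); rewrite -[ltRHS]invrK ltf_pV2 ?posrE ?ltr0Sn ?invr_gt0 //.
by rewrite (lt_trans (archi_boundP e10)) // ltr_nat.
Qed.

(** The metric is the supremum of the differences [|h k z - h k w|] divided by [k + 1]. A separating
    [h k] puts the ball of radius [1 / (k + 1)] inside [A]; conversely, only finitely many terms can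
    exceed a given bound, so balls are neighbourhoods. *)
Lemma metrizable_of_functions (R : realType) (T : topologicalType) (h : nat -> T -> R) :
  (forall k, continuous (h k)) -> (forall k z, 0 <= h k z <= 1) ->
  (forall w : T, closed [set w]) ->
  (forall z A, nbhs z A -> exists k, h k z = 0 /\ forall w, ~ A w -> h k w = 1) ->
  metrizable R T.
Proof.
move=> ch h01 T1 hsep.
pose D z w := [set `|h k z - h k w| / k.+1%:R | k in [set: nat]].
have Dle1 z w k : `|h k z - h k w| / k.+1%:R <= 1.
  rewrite ler_pdivrMr ?ltr0Sn // mul1r (@le_trans _ _ 1) ?ler1n // ler_norml.
  by have := h01 k z; have := h01 k w; lra.
have Dsup z w : has_sup (D z w).
  by split; [exists (`|h 0%N z - h 0%N w| / 1%:R), 0%N|exists 1 => _ [k _ <-]].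
pose d z w := sup (D z w).
have dge z w k : `|h k z - h k w| / k.+1%:R <= d z w.
  by apply: (ub_le_sup (proj2 (Dsup z w))); exists k.
have dle z w c : (forall k, `|h k z - h k w| / k.+1%:R <= c) -> d z w <= c.
  by move=> hc; apply: ge_sup; [exact: (proj1 (Dsup z w))|move=> _ [k _ <-]].
have d0 z w : 0 <= d z w by apply: le_trans (dge z w 0%N); rewrite divr_ge0.
exists d; split=> // [z w|z w|z w y|z A].
- split=> [dzw|->]; last first.
    by apply/eqP; rewrite eq_le d0 andbT dle // => k; rewrite subrr normr0 mul0r.
  apply: contrapT => zw.
  have [|k [hz hw]] := hsep z (~` [set w]).
    by apply: open_nbhs_nbhs; split=> //; exact: closed_openC.
  have := dge z w k; rewrite dzw hz hw; last exact.
  by rewrite sub0r normrN normr1 leNgt divr_gt0 ?ltr0Sn.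
- by apply/eqP; rewrite eq_le !dle // => k; rewrite distrC dge.
- apply: dle => k; apply: (@le_trans _ _ (`|h k z - h k w| / k.+1%:R + `|h k w - h k y| / k.+1%:R)).
    by rewrite -mulrDl ler_wpM2r // ?invr_ge0 // -[h k z - h k y](subrKA (h k w)) ler_normD.
  by rewrite lerD.
- split=> [/hsep[k [hz hA]]|[e e0 eA]].
    exists k.+1%:R^-1; first by rewrite invr_gt0 ltr0Sn.
    move=> w /= dzw; apply: contrapT => /hA hw.
    by have := le_lt_trans (dge z w k) dzw; rewrite hz hw sub0r normrN normr1 mul1r ltxx.
  have [K Ke] := ex_invnS_lt (divr_gt0 e0 (ltr0Sn R 1)).
  have nK : \forall w \near z, forall k : 'I_K.+1, `|h k z - h k w| < e / 2.
    apply: filter_forall => k; have /cvgr_dist_lt := ch k z; apply; first exact: divr_gt0.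
  apply: filterS nK => w wK; apply: eA => /=.
  apply: (@le_lt_trans _ _ (e / 2)); last by rewrite ltr_pdivrMr // ltr_pMr // ltr1n.
  apply: dle => k; have [kK|Kk] := ltnP k K.+1.
    apply: (@le_trans _ _ `|h k z - h k w|); last exact: ltW (wK (Ordinal kK)).
    by rewrite ler_piMr // invf_le1 ?ltr0Sn // ler1n.
  apply: (@le_trans _ _ K.+1%:R^-1); last exact: ltW.
  apply: (@le_trans _ _ k.+1%:R^-1); last first.
    by rewrite lef_pV2 ?posrE ?ltr0Sn // ler_nat ltnS ltnW.
  rewrite ler_piMl ?invr_ge0 //.
  by rewrite ler_norml; have := h01 k z; have := h01 k w; lra.
Qed.

Lemma rV_rat_ball (R : realType) n (x : 'rV[R]_n) (U : set 'rV[R]_n) : nbhs x U ->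
  exists ck : 'rV[rat]_n * nat,
    ball (map_mx ratr ck.1 : 'rV[R]_n) ck.2.+1%:R^-1 x /\
    ball (map_mx ratr ck.1 : 'rV[R]_n) ck.2.+1%:R^-1 `<=` U.
Proof.
move=> /nbhs_ballP[e /= e0 eU].
have [k ke] := ex_invnS_lt (divr_gt0 e0 (ltr0Sn R 1)).
have k0 : 0 < k.+1%:R^-1 :> R by rewrite invr_gt0 ltr0Sn.
have /choice[c cx] : forall i : 'I_n, exists q : rat, `|ratr q - x ord0 i| < k.+1%:R^-1.
  move=> i; have [|q] := @rat_in_itvoo R (x ord0 i - k.+1%:R^-1) (x ord0 i + k.+1%:R^-1).
    by rewrite ltrD2l (lt_trans _ k0) // oppr_lt0.
  by rewrite in_itv /= => qx; exists q; rewrite ltr_norml ltrBlDl ltrBrDl; move: qx; rewrite addrC.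
exists (\row_i c i, k); split=> [|y] /=; rewrite -ball_normE /=.
  by apply: rV_norm_ltP => // i; rewrite !mxE.
move=> cy; apply: eU; rewrite -ball_normE /=.
rewrite -[x - y](subrKA (map_mx ratr (\row_i c i))) (le_lt_trans (ler_normD _ _)) //.
rewrite [e]splitr ltrD // ?(lt_trans cy) // (lt_trans _ ke) //.
by apply: rV_norm_ltP => // i; rewrite !mxE distrC.
Qed.

(** Finite unions of rational balls form a countable neighbourhood basis for all compact sets at
    once. Applied to fibers, it gives second countability of the quotient. *)
Lemma rV_compact_basis (R : realType) n (K U : set 'rV[R]_n) : compact K -> open U -> K `<=` U ->
  exists s : seq ('rV[rat]_n * nat),
    let B := [set x | exists2 ck, ck \in s &
      ball (map_mx ratr ck.1 : 'rV[R]_n) ck.2.+1%:R^-1 x] in K `<=` B /\ B `<=` U.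
Proof.
move=> cK oU KU.
pose b (ck : 'rV[rat]_n * nat) := ball (map_mx ratr ck.1 : 'rV[R]_n) ck.2.+1%:R^-1.
have := cK; rewrite compact_cover => /(_ _ [set ck | b ck `<=` U] b)[].
- by move=> ck _; apply: ball_open; rewrite invr_gt0 ltr0Sn.
- move=> x /KU Ux; have [ck [xb bU]] := rV_rat_ball (open_nbhs_nbhs (conj oU Ux)).
  by exists ck.
move=> D DU KD; exists (finmap.enum_fset D); split=> [x /KD[ck]|x [ck ckD]].
  by exists ck.
by have /set_mem := DU _ ckD; apply.
Qed.

(** What the argument uses of the decomposition map, detached from the encoding of the quotient; the
    last clause is convexity of the fibers. *)
Definition convex_quotient (R : realType) n (X : topologicalType) (p : 'rV[R]_n -> X) :=
  [/\ continuous p, (forall A, open (p @^-1` A) -> open A), (forall z, exists x, p x = z),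
      proper_map p & forall x y z t, p x = p z -> p y = p z -> 0 <= t <= 1 ->
        p (x + t *: (y - x)) = p z].

Section convex_quotient_topology.
Variables (R : realType) (n : nat) (X : topologicalType) (p : 'rV[R]_n -> X).
Hypothesis pq : convex_quotient p.
Local Notation V := 'rV[R]_n.
Implicit Types (x y : V) (U K : set V).

Lemma fiber_compact w : compact (p @^-1` [set w]).
Proof. by have [_ _ _ pp _] := pq; apply: pp; exact: compact_set1. Qed.

Lemma rV_hausdorff : hausdorff_space V.
Proof. exact: norm_hausdorff. Qed.

Lemma compact_norm_ball x r : compact [set y | `|x - y| <= r].
Proof.
apply: bounded_closed_compact.
  exists (`|x| + r); split=> [|M xM y /= xy]; first exact: num_real.
  rewrite -[y](subKr x) (le_trans (ler_normB _ _)) // (le_trans _ (ltW xM)) //.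
  by rewrite lerD2l.
have -> : [set y | `|x - y| <= r] = (fun y => `|x - y|) @^-1` [set z | z <= r] by [].
apply: closed_comp => [y _|]; last exact: closed_le.
by apply: cont_norm; apply: contB; [exact: cst_continuous|exact: cont_id].
Qed.

Lemma saturation_compact K : compact K -> compact (p @^-1` (p @` K)).
Proof.
have [cp _ _ pp _] := pq; move=> cK; apply: pp.
by apply: continuous_compact => //; exact: continuous_subspaceT.
Qed.

(** The classical form of upper semicontinuity. The saturations [P r] of closed balls around [x] are
    compact and shrink to the fiber of [x], so by compactness of the part of [P 1] outside [U] a
    small [P r] lies in [U]. *)
Lemma fiber_usc U x : open U -> p @^-1` [set p x] `<=` U ->
  \forall y \near x, p @^-1` [set p y] `<=` U.
Proof.
move=> oU xU.
have [cp _ _ _ _] := pq.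
pose P r := p @^-1` (p @` [set y | `|x - y| <= r]).
have cP r : compact (P r) by apply: saturation_compact; exact: compact_norm_ball.
have clP r : closed (P r) by apply: compact_closed => //; exact: rV_hausdorff.
have cK : compact (P 1 `\` U).
  by apply: compact_closedI => //; exact: open_closedC.
have cx y : closed (p @^-1` [set p y]).
  by apply: compact_closed; [exact: rV_hausdorff|exact: fiber_compact].
have : \forall r \near 0^'+, P 1 `\` U `<=` ~` P r.
  move/compact_near_coveringP : cK; apply=> y [_ Uy].
  have xy : ~ (p @^-1` [set p y]) x by move=> /= xy; apply: Uy; apply: xU => /=.
  have : nbhs x (~` (p @^-1` [set p y])).
    by apply: open_nbhs_nbhs; split=> //; exact: closed_openC.
  move=> /nbhs_ballP[r /= r0 rxy]; exists (~` P (r / 2), [set s | s < r / 2]); [split=> /=|].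
  - apply: open_nbhs_nbhs; split; first exact: closed_openC.
    move=> [z /= xz pzy]; apply: (rxy z) => //; rewrite -ball_normE /= (le_lt_trans xz) //.
    by rewrite ltr_pdivrMr // ltr_pMr // ltr1n.
  - by apply: nbhs_right_lt; rewrite divr_gt0.
  - move=> [z s] /= [Pz sr] [z' /= xz' pz'z]; apply: Pz; exists z' => //=.
    by rewrite (le_trans xz') // ltW.
move=> [r /= r0 rP]; apply/nbhs_ballP; have r20 : 0 < r / 2 by rewrite divr_gt0.
exists (Num.min 1 (r / 2)) => /=.
  by rewrite lt_min ltr01 divr_gt0.
move=> y; rewrite -ball_normE /= lt_min => /andP[xy1 xyr] z /= pzy.
apply: contrapT => Uz; apply: (rP (r / 2) _ _ z) => //=.
- by rewrite sub0r normrN gtr0_norm // ltr_pdivrMr // ltr_pMr // ltr1n.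
- by split=> //; exists y => //=; exact: ltW.
- by exists y => //=; exact: ltW.
Qed.

(** This turns open sets of the total space, saturated or not, into open sets of the quotient. *)
Definition inner (U : set V) : set X := [set w | p @^-1` [set w] `<=` U].

Lemma open_inner U : open U -> open (inner U).
Proof.
have [_ pO _ _ _] := pq; move=> oU; apply: pO; rewrite openE => x /= xU.
exact: fiber_usc.
Qed.

Lemma closed_fiber w : closed (p @^-1` [set w]).
Proof. by apply: compact_closed; [exact: rV_hausdorff|exact: fiber_compact]. Qed.

Lemma closed_point (w : X) : closed [set w].
Proof.
have [_ pO _ _ _] := pq; rewrite -openC; apply: pO.
exact: closed_openC (@closed_fiber w).
Qed.

Lemma inner_disjoint U W : U `&` W = set0 -> inner U `&` inner W = set0.
Proof.
have [_ _ ps _ _] := pq.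
rewrite -!subset0 => UW w [wU wW]; have [x xw] := ps w.
by apply: (UW x); split; [exact: wU|exact: wW].
Qed.

Lemma convex_quotient_normal : normal_space X.
Proof.
have [cp _ _ _ _] := pq.
apply/(@normal_openP R) => A B cA cB AB.
have /(@normal_openP R)/(_ (p @^-1` A) (p @^-1` B)) := @pseudometric_normal R V.
case=> [|||U [W [oU oW AU BW UW]]].
- by move/continuous_closedP : cp; exact.
- by move/continuous_closedP : cp; exact.
- by rewrite -preimage_setI AB preimage_set0.
exists (inner U), (inner W); split; [exact: open_inner|exact: open_inner| | |exact: inner_disjoint].
  by move=> w Aw x /= xw; apply: AU; rewrite /= xw.
by move=> w Bw x /= xw; apply: BW; rewrite /= xw.
Qed.

Lemma convex_quotient_separator (w : X) (A : set X) : nbhs w A ->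
  exists f : X -> R, [/\ continuous f, forall z, 0 <= f z <= 1, f w = 0 &
    forall z, ~ A z -> f z = 1].
Proof.
rewrite nbhsE => -[B [oB Bw] BA].
have : uniform_separator [set w] (~` B).
  move/(@normal_separatorP R) : convex_quotient_normal; apply.
  - exact: closed_point.
  - exact: open_closedC.
  - by rewrite -subset0 => z [/= ->].
move=> /(@uniform_separatorP X R)[f [cf f01 f0 f1]].
exists f; split=> //.
- by move=> z; have /= := f01 (f z); rewrite in_itv /=; apply; exists z.
- by apply: f0; exists w.
- by move=> z Az; apply: f1; exists z => // /BA.
Qed.

(** Urysohn's metrization: the sets [B s] form a countable basis, and one function is chosen for
    each pair of them that can be separated. *)
Lemma convex_quotient_metrizable : metrizable R X.
Proof.
have [cp pO ps _ _] := pq.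
pose I := seq ('rV[rat]_n * nat).
pose B (s : I) := inner [set x | exists2 ck, ck \in s &
      ball (map_mx ratr ck.1 : V) ck.2.+1%:R^-1 x].
have oB s : open (B s).
  apply: open_inner; rewrite openE => x [ck cks ckx].
  have : nbhs x (ball (map_mx ratr ck.1 : V) ck.2.+1%:R^-1).
    by apply: open_nbhs_nbhs; split=> //; apply: ball_open; rewrite invr_gt0 ltr0Sn.
  by apply: filterS => y cky; exists ck.
have basis w A : nbhs w A -> exists s, B s w /\ B s `<=` A.
  rewrite nbhsE => -[A' [oA' A'w] AA'].
  have [||s /= [wB BA]] := @rV_compact_basis R n (p @^-1` [set w]) (p @^-1` A') (@fiber_compact w).
  - by move/continuousP : cp; exact.
  - by move=> x /= ->.
  exists s; split=> // z zB; apply: AA'; have [x xz] := ps z.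
  by rewrite -xz; apply: BA; exact: zB.
pose good (st : I * I) (f : X -> R) := [/\ continuous f, forall z, 0 <= f z <= 1,
   forall z, B st.1 z -> f z = 0 & forall z, ~ B st.2 z -> f z = 1].
(* Pairs without a separating function get the zero function. *)
have /choice[g gP] st : exists g : X -> R, [/\ continuous g, forall z, 0 <= g z <= 1 &
    (exists f, good st f) -> good st g].
  have [[f fg]|nf] := pselect (exists f, good st f); first by exists f; case: fg => *; split.
  exists (fun=> 0); split=> //; first exact: cst_continuous.
  by move=> z; rewrite lexx ler01.
pose h k := if unpickle k is Some st then g st else fun=> 0.
apply: (@metrizable_of_functions R X h) => [k|k z|w|z A zA].
- by rewrite /h; case: unpickle => [st|]; [case: (gP st)|exact: cst_continuous].
- by rewrite /h; case: unpickle => [st|]; [case: (gP st)|rewrite lexx ler01].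
- exact: closed_point.
have [t [Bt tA]] := basis _ _ zA.
have [f [cf f01 fz fB]] := convex_quotient_separator (open_nbhs_nbhs (conj (oB t) Bt)).
have fz2 : nbhs z [set w | f w < 2^-1].
  have fz2 : f z < 2^-1 by rewrite fz invr_gt0.
  exact: (cf z _ (lt_nbhsl fz2)).
have [s [Bs sf]] := basis _ _ fz2.
exists (pickle (s, t)); rewrite /h pickleK.
have [_ _ [|cg g01 g0 g1]] := gP (s, t); last first.
  by split=> [|w Aw]; [exact: g0|apply: g1 => /tA].
(* Cutting [f] off at one half makes it vanish on the whole basic set [B s], not only at [z]. *)
exists (fun w => Num.max 0 (2 * f w - 1)); split=> [|w|w /sf /= fw|w /fB fw].
- by apply: cont_max; [exact: cst_continuous|apply: contB; [apply: contM|]; try exact: cst_continuous].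
- by rewrite le_max lexx /= ge_max ler01 /=; have := f01 w; lra.
- by apply: max_l; move: fw; lra.
- by rewrite fw; rewrite max_r; lra.
Qed.

End convex_quotient_topology.

(** * Convex neighbourhoods and approximate selections *)

Definition convexP (R : realType) n (C : set 'rV[R]_n) :=
  forall x y t, C x -> C y -> 0 <= t <= 1 -> C (x + t *: (y - x)).

Definition thick (R : realType) n (F : set 'rV[R]_n) (e : R) :=
  [set x | exists2 y, F y & `|y - x| < e].

Section convexity.
Variables (R : realType) (n : nat).
Local Notation V := 'rV[R]_n.
Implicit Types (C F : set V) (x y : V).

Lemma thick_convex F e : convexP F -> convexP (thick F e).
Proof.
move=> cF x y t [x' Fx xx'] [y' Fy yy'] /andP[t0 t1].
exists (x' + t *: (y' - x')); first by apply: cF; rewrite ?t0.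
have -> : x' + t *: (y' - x') - (x + t *: (y - x)) = (1 - t) *: (x' - x) + t *: (y' - y).
  by apply/rowP => i; rewrite !mxE; ring.
rewrite (le_lt_trans (ler_normD _ _)) // !normrZ !ger0_norm ?subr_ge0 //.
have [->|tn0] := eqVneq t 0; first by rewrite subr0 mul1r mul0r addr0.
have -> : e = (1 - t) * e + t * e by ring.
rewrite ler_ltD //; first by rewrite ler_wpM2l ?subr_ge0 // ltW.
by rewrite ltr_pM2l // lt_neqAle eq_sym tn0.
Qed.

Lemma thick_open F e : open (thick F e).
Proof.
rewrite openE => x [y Fy yx].
have : nbhs x (ball x (e - `|y - x|)).
  by apply: nbhsx_ballx; rewrite subr_gt0.
apply: filterS => z; rewrite -ball_normE /= => xz; exists y => //.
by rewrite -[y - z](subrKA x) (le_lt_trans (ler_normD _ _)) // -ltrBrDl.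
Qed.

Lemma sub_thick F e : 0 < e -> F `<=` thick F e.
Proof. by move=> e0 x Fx; exists x; rewrite // subrr normr0. Qed.

Lemma thick_le F e e' : e <= e' -> thick F e `<=` thick F e'.
Proof. by move=> ee' x [y Fy yx]; exists y; rewrite // (lt_le_trans yx). Qed.

Lemma weighted_mean_in (I : Type) (r : seq I) (w : I -> R) (q : I -> V) C :
  convexP C -> (forall i, 0 <= w i) -> (forall i, w i != 0 -> C (q i)) ->
  0 < \sum_(i <- r) w i ->
  C ((\sum_(i <- r) w i)^-1 *: (\sum_(i <- r) w i *: q i)).
Proof.
move=> cC w0 wC.
(* The induction also has to allow that all weights so far vanish. Otherwise a new point moves the
   mean towards it along a segment. *)
suff [[-> _]|[]//] : (\sum_(i <- r) w i = 0 /\ \sum_(i <- r) w i *: q i = 0) \/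
    (0 < \sum_(i <- r) w i /\ C ((\sum_(i <- r) w i)^-1 *: (\sum_(i <- r) w i *: q i))).
  by rewrite ltxx.
elim: r => [|i r IHr]; first by rewrite !big_nil; left.
rewrite !big_cons; have [wi0|wi_neq0] := eqVneq (w i) 0.
  by rewrite wi0 scale0r !add0r.
have wi_gt0 : 0 < w i by rewrite lt_neqAle eq_sym wi_neq0 w0.
right; case: IHr => [[-> ->]|[]].
  by rewrite !addr0 scalerA mulVf // scale1r; split=> //; exact: wC.
set S := \sum_(j <- r) w j; set v := \sum_(j <- r) _ => S0 Cv.
split; first exact: addr_gt0.
have -> : (w i + S)^-1 *: (w i *: q i + v) =
    S^-1 *: v + (w i / (w i + S)) *: (q i - S^-1 *: v).
  apply/rowP => j; rewrite !mxE; field.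
  by rewrite !gt_eqF // addr_gt0.
apply: cC => //; first exact: wC.
apply/andP; split; first by rewrite divr_ge0 // ltW // addr_gt0.
by rewrite ler_pdivrMr ?addr_gt0 // mul1r lerDl ltW.
Qed.

Lemma rV_separator (A B : set V) : closed A -> closed B -> A `&` B = set0 ->
  exists f : V -> R, [/\ continuous f, forall x, 0 <= f x <= 1,
    forall x, A x -> f x = 0 & forall x, B x -> f x = 1].
Proof.
move=> cA cB AB.
have /(@normal_separatorP R)/(_ A B cA cB AB) := @pseudometric_normal R V.
move=> /(@uniform_separatorP V R)[f [cf f01 f0 f1]].
exists f; split=> // x; first by have /= := f01 (f x); rewrite in_itv /=; apply; exists x.
- by move=> Ax; apply: f0; exists x.
- by move=> Bx; apply: f1; exists x.
Qed.

End convexity.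

Section convex_quotient_selection.
Variables (R : realType) (n : nat) (X : topologicalType) (p : 'rV[R]_n -> X).
Hypothesis pq : convex_quotient p.
Local Notation V := 'rV[R]_n.
Local Notation fib x := (p @^-1` [set p x]).
Implicit Types (x y : V) (U K s : set V).

Lemma fib_convex w : convexP (p @^-1` [set w]).
Proof.
have [_ _ _ _ cv] := pq; move=> x y t /= xw yw t01.
by rewrite -xw; apply: cv; rewrite // yw.
Qed.

(** A substitute for local convexity of the quotient: a convex set fits between the preimages of two
    concentric balls, with radii uniform over [Z]. It is a thin neighbourhood of a single
    element. *)
Lemma convex_nbhs (d : X -> X -> R) (Z : set X) (e : R) : compatible_metric d -> compact Z -> 0 < e ->
  exists2 delta : R, 0 < delta & forall z, Z z -> exists C : set V,
    [/\ convexP C, forall x, d z (p x) < delta -> C x & forall x, C x -> d z (p x) < e].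
Proof.
have [cp _ ps _ _] := pq; move=> dX cZ e0.
have [_ dE dC dD dn] := dX.
pose F := [set W : set X | exists C : set V, [/\ convexP C, forall x, W (p x) -> C x &
  forall x y, C x -> C y -> d (p x) (p y) < e]].
have [|delta delta0 deltaF] := lebesgue_number (F := F) dX cZ.
  move=> z _; have : nbhs z [set w | d z w < e / 2] by apply/dn; exists (e / 2); rewrite ?divr_gt0.
  rewrite {1}nbhsE => -[N [oN Nz] Ne].
  have oU : open (p @^-1` N) by move/continuousP : cp; exact.
  have [|eta eta0 etaU] := compact_ball_sub (norm_compatible_metric V) (@fiber_compact _ _ _ _ pq z) oU.
    by move=> x /= ->.
  exists (inner p (thick (p @^-1` [set z]) eta)); last first.
    apply: open_nbhs_nbhs; split; first by apply: (open_inner pq); exact: thick_open.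
    exact: sub_thick.
  exists (thick (p @^-1` [set z]) eta); split.
  - by apply: thick_convex; exact: fib_convex.
  - by move=> x; exact.
  - have zO x : thick (p @^-1` [set z]) eta x -> d z (p x) < e / 2.
      by move=> [x' x'z x'x]; apply: Ne; exact: (etaU x').
    move=> x y /zO zx /zO zy; rewrite (le_lt_trans (dD _ z _)) // [e]splitr ltrD //.
    by rewrite dC.
exists delta => // z /deltaF[W [C [cC WC Ce]] zW]; exists C; split=> // x.
  by move=> zx; apply: WC; exact: zW.
have [x0 x0z] := ps z => Cx; rewrite -x0z; apply: Ce => //; apply: WC; apply: zW => /=.
by rewrite x0z (proj2 (dE _ _)).
Qed.

(** Points [sel i] of [s] in the elements of finitely many [i] in [K] are averaged with bump
    functions as weights. Elements of points close to [x] lie in a thin convex neighbourhood of one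
    element, and so does the average. *)
Lemma approximate_selection K s (eta : R) y0 : compact K -> convexP s -> s y0 ->
  (forall x, K x -> exists2 y, s y & p y = p x) -> 0 < eta ->
  exists r : V -> V, [/\ continuous r, forall x, s (r x) &
    forall x, K x -> exists2 x0, K x0 &
      [/\ `|x0 - x| < eta, thick (fib x0) eta x & thick (fib x0) eta (r x)]].
Proof.
move=> cK cs sy0 Ks eta0.
have /choice[sel selP] x : exists y, K x -> s y /\ p y = p x.
  have [Kx|nKx] := pselect (K x); last by exists 0.
  by have [y sy pyx] := Ks x Kx; exists y.
pose F := [set W : set V | exists2 x0, K x0 & forall x, W x ->
   `|x0 - x| < eta /\ fib x `<=` thick (fib x0) eta].
have [|delta delta0 deltaF] := lebesgue_number (F := F) (norm_compatible_metric V) cK.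
  move=> x Kx; exists [set y | `|x - y| < eta /\ fib y `<=` thick (fib x) eta].
    by exists x.
  apply: filterI; first by apply/nbhs_ballP; exists eta => // y; rewrite -ball_normE.
  by apply: (fiber_usc pq); [exact: thick_open|exact: sub_thick].
have := cK; rewrite compact_cover => /(_ _ K (fun x => ball x delta))[].
- by move=> x _; exact: ball_open.
- by move=> x Kx; exists x => //; exact: ballxx.
move=> D DK KD; have {}DK i : i \in finmap.enum_fset D -> K i by move=> iD; apply/set_mem/DK.
pose w (i x : V) : R := Num.max 0 (delta - `|i - x|).
have w_ge0 i x : 0 <= w i x by rewrite le_max lexx.
have cw i : continuous (w i).
  apply: cont_max; first exact: cst_continuous.
  apply: contB; first exact: cst_continuous.
  by apply: cont_norm; apply: contB; [exact: cst_continuous|exact: cont_id].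
pose S x := \sum_(i <- finmap.enum_fset D) w i x.
have cS : continuous S by apply: cont_sum.
have S_ge0 x : 0 <= S x by apply: sumr_ge0.
have w_gt0 i x : (w i x != 0) = (`|i - x| < delta).
  rewrite /w; have [ix|ix] := ltP `|i - x| delta; last by rewrite max_l ?eqxx ?subr_le0.
  by rewrite max_r ?gt_eqF ?subr_gt0 // subr_ge0 ltW.
have S_gt0 x : K x -> 0 < S x.
  move=> /KD[i iD]; rewrite -ball_normE /= => ix.
  rewrite lt_neqAle S_ge0 andbT eq_sym; apply/negP; rewrite psumr_eq0 // => /allP/(_ i iD).
  by apply/negP; rewrite w_gt0.
(* [psi] is an extra weight, for the point [y0]: it vanishes on [K] and keeps the total weight
   positive where all bumps vanish. *)
have [|||psi [cpsi psi01 psi0 psi1]] := @rV_separator R n K (S @^-1` [set 0]).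
- by apply: compact_closed => //; exact: rV_hausdorff.
- by apply: closed_comp => [y _|]; [exact: cS|exact: closed_eq].
- by rewrite -subset0 => x [/S_gt0 Sx /= Sx0]; rewrite Sx0 ltxx in Sx.
(* The index [None] stands for [y0]; the membership test ensures that a nonzero weight at [Some i]
   comes with [i] in [K]. *)
pose wt x (o : option V) := if o is Some i then if i \in finmap.enum_fset D then w i x else 0 else psi x.
pose pt (o : option V) := if o is Some i then sel i else y0.
pose idx := None :: [seq Some i | i <- finmap.enum_fset D].
have wtS x : \sum_(o <- idx) wt x o = psi x + S x.
  rewrite big_cons big_map /=; congr (_ + _); rewrite big_seq [RHS]big_seq.
  by apply: eq_bigr => i iD; rewrite ifT.
have wt_ge0 x o : 0 <= wt x o.
  by case: o => [i|] /=; [case: ifP|have := psi01 x; lra].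
have wtS_gt0 x : 0 < \sum_(o <- idx) wt x o.
  rewrite wtS; have := S_ge0 x; rewrite le_eqVlt => /predU1P[S0|]; last first.
    by have := psi01 x; lra.
  by rewrite psi1 // -S0 addr0.
have cwt o : continuous (wt^~ o).
  by case: o => [i|] //=; case: (i \in finmap.enum_fset D) => //; exact: cst_continuous.
exists (fun x => (\sum_(o <- idx) wt x o)^-1 *: (\sum_(o <- idx) wt x o *: pt o)); split.
- apply: contZ; first by apply: contV => [x|]; [rewrite gt_eqF|apply: cont_sum].
  by apply: cont_sum => o; apply: contZ => //; exact: cst_continuous.
- move=> x; apply: weighted_mean_in => // -[i|] //=.
  case: ifP => [/DK Ki _|]; last by rewrite eqxx.
  by have [] := selP i Ki.
move=> x Kx; have [W [x0 Kx0 x0W] xW] := deltaF x Kx.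
have Wx : W x by apply: xW; rewrite /= subrr normr0.
exists x0 => //; have [x0x fx] := x0W x Wx; split=> //; first exact: fx.
apply: weighted_mean_in => //; first by apply: thick_convex; exact: fib_convex.
move=> [i|] /=; last by rewrite psi0 // eqxx.
case: ifP => [/DK Ki|]; last by rewrite eqxx.
rewrite w_gt0 => ix; have [|_ fi] := x0W i; first by apply: xW; rewrite /= distrC.
by have [_ pi] := selP i Ki; exact: fi.
Qed.

(** If the element of [x] comes close to a point [c] of [S], upper semicontinuity at [c] puts it
    near the element of [c], which lies in [U] by saturation. Compactness of [S] makes the distance
    uniform. *)
Lemma thick_fiber_sub U S : open U -> (forall x y, p x = p y -> U x -> U y) ->
  compact S -> S `<=` U ->
  exists2 eta : R, 0 < eta & forall x, S `&` thick (fib x) eta !=set0 ->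
    forall y, `|x - y| < eta -> U y.
Proof.
move=> oU satU cS SU.
have [|eta /= eta0 etaS] := proj1 (compact_near_coveringP S) cS R 0^'+
  (fun eta c => forall x, thick (fib x) eta c -> forall y, `|x - y| < eta -> U y) _.
  move=> c Sc; have cU : fib c `<=` U by move=> x cx; apply: (satU c) => //; exact: SU.
  have [|e e0 eU] := compact_ball_sub (norm_compatible_metric V) (@fiber_compact _ _ _ _ pq (p c)) oU.
    exact: cU.
  have := fiber_usc pq (@thick_open R n (fib c) (e / 2)) (@sub_thick R n _ _ (divr_gt0 e0 (ltr0Sn R 1))).
  move=> /nbhs_ballP[rho /= rho0 rhoc].
  exists (ball c (rho / 2), [set t | t < Num.min (e / 2) (rho / 2)]); first split => /=.
  - by apply: nbhsx_ballx; rewrite divr_gt0.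
  - by apply: nbhs_right_lt; rewrite lt_min !divr_gt0.
  move=> [c' t] /= []; rewrite -ball_normE /= lt_min => cc' /andP[te tr] x [x' x'x x'c'] y xy.
  have x'c : ball c rho x'.
    rewrite -ball_normE /= -[c - x'](subrKA c') [rho]splitr.
    by rewrite (le_lt_trans (ler_normD _ _)) // ltrD // distrC (lt_trans x'c').
  have [|z zc zx] := rhoc x' x'c x; first by rewrite /= x'x.
  apply: (eU z) => //=; rewrite -[z - y](subrKA x) [e]splitr.
  by rewrite (le_lt_trans (ler_normD _ _)) // ltrD // (lt_trans xy).
have eta20 : 0 < eta / 2 by rewrite divr_gt0.
exists (eta / 2) => // x [c [Sc xc]] y xy; apply: (etaS (eta / 2) _ _ c Sc x xc y xy) => //=.
by rewrite sub0r normrN gtr0_norm // ltr_pdivrMr // ltr_pMr // ltr1n.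
Qed.

(* The straight-line homotopy from x to r x moves points of the saturation K of
   s inside thin neighbourhoods of the elements, hence misses a and b when they
   are off K, and hits the segment [a, b] only where the cutoff mu is 1. *)
Lemma selection_homotopy U s y0 (a b : V) :
  open U -> (forall x y, p x = p y -> U x -> U y) ->
  (forall t, 0 <= t <= 1 -> U (a + t *: (b - a))) ->
  compact s -> convexP s -> s y0 -> let K := p @^-1` (p @` s) in
  exists (r : V -> V) (mu : V -> R),
    [/\ continuous r /\ continuous mu, forall x, s (r x), forall x, 0 <= mu x <= 1,
        forall x, ~ U x -> mu x = 0 &
      forall x, K x ->
       [/\ mu x = 1 \/ (forall l t, 0 <= l <= 1 -> 0 <= t <= 1 ->
              x + l *: (r x - x) != a + t *: (b - a)),
            ~ K a -> forall l, 0 <= l <= 1 -> x + l *: (r x - x) != a &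
            ~ K b -> forall l, 0 <= l <= 1 -> x + l *: (r x - x) != b]].
Proof.
move=> oU satU abU cs cvs sy0 K.
have cK : compact K by exact: saturation_compact.
have clK : closed K by apply: compact_closed => //; exact: rV_hausdorff.
have satK x y : p x = p y -> K x -> K y.
  by move=> pxy [z sz zx]; exists z => //; rewrite zx.
have c01 : compact `[0, 1 : R]%classic by exact: segment_compact.
have ccab : continuous (fun t : R => a + t *: (b - a)).
  apply: contD; first exact: cst_continuous.
  by apply: contZ; [exact: cont_id|exact: cst_continuous].
have [||eta1 eta10 eta1U] := thick_fiber_sub
    (S := (fun t => a + t *: (b - a)) @` `[0, 1 : R]%classic) oU satU.
- by apply: continuous_compact => //; exact: continuous_subspaceT.
- by move=> _ [t /= t01 <-]; apply: abU; move: t01; rewrite in_itv.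
(* For [c] off [K], the preceding lemma applies to the saturated open complement of [K] and the
   compact set [{c}]. *)
have off c : exists2 eta : R, 0 < eta & ~ K c -> forall x, K x -> ~ thick (fib x) eta c.
  have [Kc|Kc] := pselect (K c); first by exists 1.
  have [||||eta eta0 etaK] := @thick_fiber_sub (~` K) [set c].
  - exact: closed_openC.
  - by move=> x y pxy Kx Ky; apply: Kx; exact: (satK y).
  - exact: compact_set1.
  - by move=> x /= ->.
  exists eta => // _ x Kx xc; apply: (etaK x _ x) Kx; first by exists c.
  by rewrite subrr normr0.
have [eta2 eta20 eta2a] := off a; have [eta3 eta30 eta3b] := off b.
pose eta := Num.min eta1 (Num.min eta2 eta3).
have eta0 : 0 < eta by rewrite !lt_min eta10 eta20.
have Ks x : K x -> exists2 y, s y & p y = p x by [].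
have [r [cr sr rK]] := approximate_selection cK cvs sy0 Ks eta0.
have hK x l : K x -> 0 <= l <= 1 -> exists2 x0, K x0 &
    `|x0 - x| < eta /\ thick (fib x0) eta (x + l *: (r x - x)).
  move=> /rK[x0 Kx0 [x0x tx trx]] l01; exists x0 => //; split=> //.
  by apply: thick_convex => //; exact: fib_convex.
(* Points whose segment to [r x] meets [[a, b]]. Those in [K] lie in [U], so a cutoff can be 1 on
   them and 0 off [U]. *)
pose bad := [set x | exists2 lt : R * R, (`[0, 1]%classic `*` `[0, 1]%classic) lt &
  x + lt.1 *: (r x - x) - (a + lt.2 *: (b - a)) = 0].
have cbad : closed bad.
  pose C := (fun xlt : V * (R * R) => xlt.1 + xlt.2.1 *: (r xlt.1 - xlt.1) -
     (a + xlt.2.2 *: (b - a))) @^-1` [set 0].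
  suff cC : closed C by exact: (closed_proj (compact_setX c01 c01) cC).
  have c1 : continuous (fun xlt : V * (R * R) => xlt.1) by move=> ?; exact: cvg_fst.
  have c2 : continuous (fun xlt : V * (R * R) => xlt.2) by move=> ?; exact: cvg_snd.
  have c21 : continuous (fun xlt : V * (R * R) => xlt.2.1).
    by apply: (cont_comp c2) => ?; exact: cvg_fst.
  have c22 : continuous (fun xlt : V * (R * R) => xlt.2.2).
    by apply: (cont_comp c2) => ?; exact: cvg_snd.
  apply: closed_comp => [x _|]; last exact: (accessible_closed_set1 (hausdorff_accessible (@rV_hausdorff R n))).
  apply: contB; last exact: (cont_comp c22 ccab).
  apply: contD => //; apply: contZ => //; apply: contB => //.
  exact: (cont_comp c1 cr).
have badP x : K x -> bad x -> U x.
  move=> Kx [[l t] /= [l01 t01]] /subr0_eq e.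
  have l01' : 0 <= l <= 1 by move: l01; rewrite in_itv.
  have [x0 Kx0 [x0x tx]] := hK x l Kx l01'.
  apply: (eta1U x0); last by rewrite (lt_le_trans x0x) // /eta ge_min lexx.
  exists (a + t *: (b - a)); split; first by exists t.
  by rewrite -e; apply: thick_le tx; rewrite /eta ge_min lexx.
have [|||mu [cmu mu01 mu0 mu1]] := @rV_separator R n (~` U) (K `&` bad).
- exact: open_closedC.
- exact: closedI.
- by rewrite -subset0 => x [Ux [Kx xbad]]; apply: Ux; exact: badP.
exists r, mu; split=> // x Kx; split.
- have [xbad|nbad] := pselect (bad x); [by left; apply: mu1|right=> l t l01 t01].
  apply/negP => /eqP e; apply: nbad; exists (l, t) => /=; first by rewrite !in_itv.
  by rewrite e subrr.
- move=> Ka l l01; apply/negP => /eqP e; have [x0 Kx0 [_]] := hK x l Kx l01.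
  rewrite e => tx; apply: (eta2a Ka x0 Kx0); apply: thick_le tx.
  by rewrite /eta !ge_min lexx orbT.
- move=> Kb l l01; apply/negP => /eqP e; have [x0 Kx0 [_]] := hK x l Kx l01.
  rewrite e => tx; apply: (eta3b Kb x0 Kx0); apply: thick_le tx.
  by rewrite /eta !ge_min lexx !orbT.
Qed.

End convex_quotient_selection.

(** * Complements of saturations of convex sets *)

(** Paths are total functions on the line; they are constrained on the unit interval only. *)
Definition joined (R : realType) (V : topologicalType) (D : set V) (x y : V) :=
  exists g : R -> V, [/\ continuous g, g 0 = x, g 1 = y & forall t, 0 <= t <= 1 -> D (g t)].

Section joined.
Variables (R : realType) (n : nat).
Local Notation V := 'rV[R]_n.
Implicit Types (D : set V) (x y z : V).

Lemma joined_refl D x : D x -> joined R D x x.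
Proof. by move=> Dx; exists (fun=> x); split=> //; exact: cst_continuous. Qed.

Lemma joined_segment D x y z : joined R D x y ->
  (forall t : R, 0 <= t <= 1 -> D (y + t *: (z - y))) -> joined R D x z.
Proof.
move=> [g [cg g0 g1 gD]] yzD.
(* First [g], then the segment, each at double speed; the truncations hold one part still while the
   other moves. *)
exists (fun t => g (Num.min 1 (2 * t)) + Num.max 0 (2 * t - 1) *: (z - y)).
have c2 : continuous (fun t : R => 2 * t).
  by apply: contM; [exact: cst_continuous|exact: cont_id].
split=> [|||t /andP[t0 t1]].
- apply: contD.
    apply: (cont_comp _ cg); apply: cont_min => //; exact: cst_continuous.
  apply: contZ; last exact: cst_continuous.
  apply: cont_max; first exact: cst_continuous.
  by apply: contB => //; exact: cst_continuous.
- by rewrite mulr0 min_r ?ler01 // max_l ?scale0r ?addr0 //; lra.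
- by rewrite mulr1 min_l ?ler1n // max_r ?g1; [rewrite (_ : 2 - 1 = 1 :> R) ?scale1r ?subrKC//; lra|lra].
have [t2|t2] := leP (2 * t) 1.
  by rewrite max_l ?scale0r ?addr0; [apply: gD; lra|lra].
by rewrite max_r ?g1; [apply: yzD; lra|lra].
Qed.

Lemma joined_nbhs D x : open D -> D x ->
  \forall y \near x, forall a, joined R D a x <-> joined R D a y.
Proof.
move=> oD Dx; have /nbhs_ballP[e /= e0 eD] := open_nbhs_nbhs (conj oD Dx).
have seg y t : ball x e y -> 0 <= t <= 1 -> ball x e (x + t *: (y - x)).
  rewrite -!ball_normE /= => xy /andP[t0 t1].
  rewrite opprD addNKr normrN normrZ ger0_norm // (le_lt_trans _ xy) //.
  by rewrite distrC ler_piMl.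
apply/nbhs_ballP; exists e => // y xy a; split=> /joined_segment; apply=> t t01.
  by apply: eD; exact: seg.
have -> : y + t *: (x - y) = x + (1 - t) *: (y - x).
  by apply/rowP => i; rewrite !mxE; ring.
by apply/eD/seg => //; lra.
Qed.

End joined.

Section saturation.
Variables (R : realType) (n : nat) (X : topologicalType) (p : 'rV[R]_n -> X).
Hypothesis pq : convex_quotient p.
Local Notation V := 'rV[R]_n.
Implicit Types (U s : set V).

(** If [U] were inside the saturation, pulling its points towards [s] would give a map that agrees
    with [x - c] off [U] and has no zeros, as [c] is not in [s]. The homotopy is used for the
    degenerate segment [[c, c]]. *)
Lemma saturation_no_interior U s (y0 c : V) : open U ->
  (forall x y, p x = p y -> U x -> U y) -> compact s -> convexP s -> s y0 ->
  U c -> ~ s c -> ~ (U `<=` p @^-1` (p @` s)).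
Proof.
move=> oU satU cs cvs sy0 Uc sc UK.
have Ucc t : 0 <= t <= 1 -> U (c + t *: (c - c)) by rewrite subrr scaler0 addr0.
have [r [mu [[cr cmu] sr mu01 mu0 rK]]] := selection_homotopy pq oU satU Ucc cs cvs sy0.
pose E x := x + mu x *: (r x - x) - c.
have cE : continuous E.
  apply: contB; last exact: cst_continuous.
  apply: contD; first exact: cont_id.
  by apply: contZ => //; apply: contB => //; exact: cont_id.
have [M UM] : exists M, forall x, U x -> `|x| < M.
  have /compact_bounded[M [_ KM]] : compact (p @^-1` (p @` s)) by exact: (saturation_compact pq).
  exists (M + 2) => x /UK Kx; have := KM (M + 1) _ x Kx; rewrite ltrDl => /(_ ltr01) /=.
  by move=> /le_lt_trans; apply; rewrite ltrD2l ltr1n.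
have [x|x] := translation_at_infinity_zero (a := c) (M := M) cE.
  move=> Mx; rewrite /E mu0 ?scale0r ?addr0 // => /UM.
  by rewrite ltNge Mx.
rewrite /E => /subr0_eq; have [Ux|Ux] := pselect (U x); last first.
  by rewrite mu0 // scale0r addr0 => xc; apply: Ux; rewrite xc.
have [[->|mun1] _ _] := rK x (UK x Ux).
  by rewrite scale1r subrKC => rc; apply: sc; rewrite -rc.
have := mun1 (mu x) 0 (mu01 x); rewrite lexx ler01 scale0r addr0 => /(_ isT)/eqP.
exact.
Qed.

Lemma joined_off_saturation U s (y0 a b : V) M : open U ->
  (forall x y, p x = p y -> U x -> U y) -> (forall x, U x -> `|x| < M) ->
  compact s -> convexP s -> s y0 -> let K := p @^-1` (p @` s) in
  ~ K a -> ~ K b ->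
  (forall t : R, 0 <= t <= 1 -> U (a + t *: (b - a)) /\ ~ s (a + t *: (b - a))) ->
  joined R (U `\` K) a b.
Proof.
move=> oU satU UM cs cvs sy0 K Ka Kb ab; apply: contrapT => nab.
have abU t : 0 <= t <= 1 -> U (a + t *: (b - a)) by move=> /ab[].
have Ua : U a by have := abU 0; rewrite scale0r addr0; apply; rewrite lexx ler01.
have [r [mu [[cr cmu] sr mu01 mu0 rK]]] := selection_homotopy pq oU satU abU cs cvs sy0.
pose D := U `\` K.
have oD : open D.
  rewrite /D setDE; apply: openI => //; apply: closed_openC.
  apply: compact_closed; first exact: rV_hausdorff.
  exact: (saturation_compact pq).
pose W := [set x | joined R D a x].
have WD x : W x -> D x.
  by move=> [g [_ _ <- gD]]; apply: gD; rewrite ler01 lexx.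
have Wa : W a by apply: joined_refl.
(* Three stages: [la] rises to 1 in the first third, [si] goes from 0 to 1 in the second, [la]
   returns to 0 in the last. *)
pose la (t : R) := Num.min 1 (Num.min (3 * t) (3 - 3 * t)).
pose si (t : R) := Num.max 0 (Num.min 1 (3 * t - 1)).
have la01 t : 0 <= t <= 1 -> 0 <= la t <= 1.
  by move=> t01; rewrite /la !le_min ge_min lexx ler01 /= andbT; lra.
have si01 t : 0 <= si t <= 1.
  by rewrite /si le_max lexx ge_max ler01 ge_min lexx.
have lasi t : 0 <= t <= 1 -> [\/ si t = 0, la t = 1 | si t = 1].
  move=> t01; have [t3|t3] := leP (3 * t) 1.
    by apply: Or31; rewrite /si max_l // ge_min; apply/orP; right; lra.
  have [t4|t4] := leP (3 * t) 2; last first.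
    by apply: Or33; rewrite /si min_l ?max_r; lra.
  by apply: Or32; rewrite /la min_l // le_min; lra.
have la0 : la 0 = 0 by rewrite /la mulr0 subr0 [Num.min 0 _]min_l ?min_r; lra.
have la1 : la 1 = 0 by rewrite /la mulr1 subrr [Num.min 3 0]min_r ?min_r; lra.
have si0 : si 0 = 0 by rewrite /si mulr0 min_r ?max_l; lra.
have si1 : si 1 = 1 by rewrite /si min_l ?max_r; lra.
have cla : continuous la.
  have c3 : continuous (fun t : R => 3 * t).
    by apply: contM; [exact: cst_continuous|exact: cont_id].
  apply: cont_min; first exact: cst_continuous.
  by apply: cont_min => //; apply: contB => //; exact: cst_continuous.
have csi : continuous si.
  apply: cont_max; first exact: cst_continuous.
  apply: cont_min; first exact: cst_continuous.
  apply: contB; last exact: cst_continuous.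
  by apply: contM; [exact: cst_continuous|exact: cont_id].
(* A homotopy from [x - a] to [x - b]: deform towards [r x], move [a] to [b], deform back. *)
pose H (x : V) (t : R) := x + (la t * mu x) *: (r x - x) - (a + si t *: (b - a)).
have cH (T : topologicalType) (f : T -> V) (t : T -> R) :
    continuous f -> continuous t -> continuous (fun z => H (f z) (t z)).
  move=> cf ct; apply: contB.
    apply: contD => //; apply: contZ.
      by apply: contM; [exact: (cont_comp ct cla)|exact: (cont_comp cf cmu)].
    by apply: contB => //; exact: (cont_comp cf cr).
  apply: contD; first exact: cst_continuous.
  by apply: contZ; [exact: (cont_comp ct csi)|exact: cst_continuous].
pose Z := [set x | exists2 t, `[0, 1]%classic t & H x t = 0].
have cZ : closed Z.
  have c01 : compact `[0, 1 : R]%classic by exact: segment_compact.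
  pose C := (fun xt : V * R => H xt.1 xt.2) @^-1` [set 0].
  suff cC : closed C by exact: (closed_proj c01 cC).
  apply: closed_comp => [x _|]; last first.
    exact: (accessible_closed_set1 (hausdorff_accessible (@rV_hausdorff R n))).
  by apply: cH => z; [exact: cvg_fst|exact: cvg_snd].
(* No zeros off [D]. Where [mu x] is not 1, the deformation misses all of [[a, b]]. Where it is 1,
   the outer stages miss [a] and [b], and in the middle one [r x] lies in [s], which [[a, b]]
   misses. *)
have ZD : ~` D `&` Z = set0.
  rewrite -subset0 => x [Dx [t]]; rewrite /= in_itv /= => t01.
  have [Ux|Ux] := pselect (U x); last first.
    rewrite /H mu0 // mulr0 scale0r addr0 => /subr0_eq xab.
    by apply: Ux; rewrite xab; exact: abU.
  have Kx : K x by apply: contrapT => Kx; exact: Dx.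
  have lm01 : 0 <= la t * mu x <= 1.
    have := la01 t t01; have := mu01 x; nra.
  rewrite /H => /subr0_eq/eqP; have [[mu1|mun1]] := rK x Kx; last first.
    move=> _ _; by rewrite (negPf (mun1 _ _ lm01 (si01 t))).
  move=> /(_ Ka _ lm01) xa /(_ Kb _ lm01) xb.
  case: (lasi t t01) => e; rewrite e.
  - by rewrite scale0r addr0 (negPf xa).
  - rewrite mu1 mulr1 scale1r subrKC => /eqP rab.
    by have [_] := ab (si t) (si01 t); apply; rewrite -rab.
  - by rewrite scale1r subrKC (negPf xb).
have [th [cth th01 th0 th1]] := rV_separator (open_closedC oD) cZ ZD.
(* Continuous, because [W] is open and closed in [D] and [th] vanishes off [D]. *)
pose tau x := if x \in W then th x else 0.
have ctau : continuous tau.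
  move=> x; have [Dx|Dx] := pselect (D x).
    have Dn := joined_nbhs oD Dx.
    have [Wx|Wx] := pselect (W x).
      rewrite /continuous_at {2}/tau ifT ?inE //.
      have thtau : \forall y \near x, th y = tau y.
        by apply: filterS Dn => y /(_ a)[+ _] => /(_ Wx) Wy; rewrite /tau ifT ?inE.
      by apply: cvg_trans (cth x); exact: near_eq_cvg thtau.
    rewrite /continuous_at {2}/tau ifF; last by apply/negP; rewrite inE.
    have tau0 : \forall y \near x, tau y = 0.
      apply: filterS Dn => y /(_ a)[_ Wy].
      by rewrite /tau ifF //; apply/negP; rewrite inE => /Wy.
    exact: cvg_near_cst tau0.
  have tx : tau x = 0 by rewrite /tau; case: ifP => // _; rewrite th0.
  rewrite /continuous_at tx => A /nbhs_ballP[e /= e0 eA].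
  have : nbhs x (th @^-1` ball (th x) e) by apply: (cth x); exact: nbhsx_ballx.
  rewrite (th0 x Dx) /=; apply: filterS => y /= ye; rewrite /tau.
  by case: ifP => _; apply: eA => //; exact: ballxx.
(* A zero in [W] would lie in [Z], where [th] is 1, so it would be [b]; a zero off [W] would be [a].
   Both are excluded. *)
pose E x := H x (tau x).
have cE : continuous E by apply: cH => //; exact: cont_id.
have H0 x : H x 0 = x - a by rewrite /H la0 mul0r si0 !scale0r !addr0.
have [x|x] := translation_at_infinity_zero (a := a) (M := M) cE.
  move=> Mx; rewrite /E /tau ifF //; apply/negP; rewrite inE => /WD[/UM + _].
  by rewrite ltNge Mx.
rewrite /E /tau; case: ifP => [|/negP]; rewrite inE => Wx.
  move=> Hx; have : Z x by exists (th x); rewrite //= in_itv /= th01.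
  move=> /th1 thx; move: Hx; rewrite thx /H la1 mul0r scale0r addr0 si1 scale1r subrKC.
  by move=> /subr0_eq xb; apply: nab; rewrite -xb.
by rewrite H0 => /subr0_eq xa; apply: Wx; rewrite xa.
Qed.

End saturation.

(** * Pushing arcs off triangles *)

Section triangle.
Variables (R : realType) (n : nat).
Local Notation V := 'rV[R]_n.
Implicit Types (a b c x y : V) (U : set V).

Definition triangle a b c : set V :=
  [set a + uv.1 *: (b - a) + uv.2 *: (c - a) | uv in
    [set uv : R * R | [/\ 0 <= uv.1, 0 <= uv.2 & uv.1 + uv.2 <= 1]]].

Lemma triangle_convex a b c : convexP (triangle a b c).
Proof.
move=> _ _ t [[u v] /= [u0 v0 uv1] <-] [[u' v'] /= [u'0 v'0 uv'1] <-] t01.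
exists (u + t * (u' - u), v + t * (v' - v)) => /=.
  by split; nra.
by apply/rowP => i; rewrite !mxE; ring.
Qed.

Lemma triangle_vertices a b c :
  [/\ triangle a b c a, triangle a b c b & triangle a b c c].
Proof.
split; [exists (0, 0)|exists (1, 0)|exists (0, 1)] => /=; rewrite ?scale0r ?scale1r ?addr0 ?subrKC //.
all: by split; lra.
Qed.

Lemma triangle_compact a b c : compact (triangle a b c).
Proof.
have c1 : continuous (fun uv : R * R => uv.1) by move=> ?; exact: cvg_fst.
have c2 : continuous (fun uv : R * R => uv.2) by move=> ?; exact: cvg_snd.
apply: continuous_compact; first apply: continuous_subspaceT.
  apply: contD; last by apply: contZ => //; exact: cst_continuous.
  apply: contD; first exact: cst_continuous.
  by apply: contZ => //; exact: cst_continuous.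
have c01 : compact `[0, 1 : R]%classic by exact: segment_compact.
have -> : [set uv : R * R | [/\ 0 <= uv.1, 0 <= uv.2 & uv.1 + uv.2 <= 1]] =
    (`[0, 1]%classic `*` `[0, 1]%classic) `&` ((fun uv : R * R => uv.1 + uv.2) @^-1` [set z | z <= 1]).
  apply/seteqP; split=> -[u v] /=; rewrite !in_itv /=.
    by move=> [u0 v0 uv]; repeat split; rewrite // ?u0 ?v0 //=; lra.
  by move=> [[/andP[u0 _] /andP[v0 _]] uv].
apply: compact_closedI; first exact: compact_setX.
apply: closed_comp => [x _|]; last exact: closed_le.
exact: (@contD R (R * R)%type R^o _ _ c1 c2).
Qed.

(** An affine subspace of dimension less than [n] has empty interior: a small step in a direction
    outside the row space leaves it. *)
Lemma generic_point m (M : 'M[R]_(m, n)) a U c : (m < n)%N -> open U -> U c ->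
  exists2 b, U b & ~~ (b - a <= M)%MS.
Proof.
move=> mn oU Uc; have [cM|] := boolP (c - a <= M)%MS; last by exists c.
have [w wM] : exists w : V, ~~ (w <= M)%MS.
  apply: contrapT => /forallNP allM.
  have : (1%:M <= M)%MS.
    by apply/row_subP => i; have /negP := allM (row i 1%:M); rewrite negbK.
  rewrite sub1mx /row_full => /eqP rM.
  by have := rank_leq_row M; rewrite rM leqNgt mn.
have /nbhs_ballP[e /= e0 eU] := open_nbhs_nbhs (conj oU Uc).
pose s := e / (1 + `|w|).
have s0 : 0 < s by rewrite divr_gt0 // ltr_pwDl.
exists (c + s *: w).
  apply: eU; rewrite -ball_normE /= opprD addNKr normrN normrZ gtr0_norm //.
  by rewrite /s mulrAC ltr_pdivrMr ?ltr_pwDl // ltr_pM2l // ltrDr.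
apply: contra wM => cwM; rewrite -[w](scalerK (lt0r_neq0 s0)); apply: scalemx_sub.
have -> : s *: w = (c + s *: w - a) - (c - a) by apply/rowP => i; rewrite !mxE; ring.
by rewrite addmx_sub // eqmx_opp.
Qed.

Lemma generic_off_triangle a b c U y : (2 < n)%N -> open U -> U y ->
  exists2 z, U z & ~ triangle a b c z.
Proof.
move=> n2 oU Uy; have [z Uz nz] := generic_point (col_mx (b - a) (c - a)) a n2 oU Uy.
exists z => // -[[u v] /= _ zE]; move/negP: nz; apply.
rewrite -zE [_ - a](_ : _ = u *: (b - a) + v *: (c - a)); last first.
  by apply/rowP => i; rewrite !mxE; ring.
by rewrite addmx_sub // scalemx_sub // -addsmxE ?addsmxSl ?addsmxSr.
Qed.

(** [z] is taken off the affine span of [x] and the triangle, of dimension at most 3. The line from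
    [x] to [z] meets this span only in [x], which is off the triangle. *)
Lemma generic_segment a b c x U y : (3 < n)%N -> open U -> U y -> ~ triangle a b c x ->
  exists2 z, U z & forall t, ~ triangle a b c (x + t *: (z - x)).
Proof.
move=> n3 oU Uy xabc.
have [z Uz nz] := generic_point (col_mx (a - x) (col_mx (b - x) (c - x))) x n3 oU Uy.
exists z => // t [[u v] /= uv01 zE].
have [t0|t0] := eqVneq t 0.
  by apply: xabc; exists (u, v); rewrite //= zE t0 scale0r addr0.
move/negP: nz; apply; rewrite -[z - x](scalerK t0); apply: scalemx_sub.
rewrite [t *: _](_ : _ = (1 - u - v) *: (a - x) + (u *: (b - x) + v *: (c - x))); last first.
  move/rowP: zE => zE; apply/rowP => i; have := zE i; rewrite !mxE => zEi.
  by rewrite -[LHS](addKr (x ord0 i)) -zEi; ring.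
rewrite -addsmxE; apply: addmx_sub; first by rewrite scalemx_sub ?addsmxSl.
apply: submx_trans (addsmxSr _ _).
by rewrite addmx_sub // scalemx_sub // -addsmxE ?addsmxSl ?addsmxSr.
Qed.

End triangle.

Section arc_pushing.
Variables (R : realType) (n : nat) (X : topologicalType) (p : 'rV[R]_n -> X).
Hypothesis pq : convex_quotient p.
Hypothesis n4 : (4 <= n)%N.
Variable d : X -> X -> R.
Hypothesis dX : compatible_metric d.
Local Notation V := 'rV[R]_n.

Lemma metric_ball_open z (r : R) : open [set w | d z w < r].
Proof.
have [_ _ _ dD dn] := dX.
rewrite openE => w /= zw; apply/dn; exists (r - d z w); rewrite ?subr_gt0 //.
by move=> y /= wy; rewrite (le_lt_trans (dD _ w _)) // -ltrBrDl.
Qed.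

Lemma uniformly_close (W : normedModType R) (K : set W) (f : W -> X) (e : R) :
  compact K -> continuous f -> 0 < e ->
  exists2 h : R, 0 < h & forall s t, K s -> `|s - t| < h -> d (f s) (f t) < e.
Proof.
have [_ dE dC dD dn] := dX.
move=> cK cf e0.
pose F := [set U : set W | forall s t, U s -> U t -> d (f s) (f t) < e].
have [|h h0 hF] := lebesgue_number (F := F) (norm_compatible_metric W) cK.
  move=> s _; exists (f @^-1` [set w | d (f s) w < e / 2]).
    move=> t u /= st su; rewrite (le_lt_trans (dD _ (f s) _)) // [e]splitr ltrD //.
    by rewrite dC.
  apply: (cf s); apply: open_nbhs_nbhs; split; first exact: metric_ball_open.
  by rewrite /= (proj2 (dE _ _)) // divr_gt0.
exists h => // s t Ks st; have [U FU sU] := hF s Ks.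
by apply: FU; apply: sU => //=; rewrite subrr normr0.
Qed.

Lemma grid_index (N : nat) (t : R) : (0 < N)%N -> 0 <= t <= 1 ->
  exists2 i : nat, (i < N)%N & exists2 u, 0 <= u <= 1 & N%:R * t = i%:R + u.
Proof.
move=> N0 /andP[t0]; rewrite le_eqVlt => /predU1P[->|t1].
  (* The right end belongs to the last cell, with [u = 1]. *)
  exists N.-1; first by rewrite prednK.
  by exists 1; rewrite ?lexx ?ler01 // mulr1 natr1 prednK.
have NR : 0 < N%:R :> R by rewrite ltr0n.
have /truncn_itv/andP[lt tl] : 0 <= N%:R * t by rewrite mulr_ge0 // ltW.
exists (Num.truncn (N%:R * t)).
  by rewrite -(ltr_nat R) (le_lt_trans lt) // gtr_pMr.
exists (N%:R * t - (Num.truncn (N%:R * t))%:R); last by rewrite subrKC.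
by rewrite subr_ge0 lt /= lerBlDl natr1 ltW.
Qed.

Lemma push_arc_off_triangle (al : R -> X) (e : R) a b c :
  continuous al -> 0 < e ->
  exists al' : R -> X, continuous al' /\ forall t, 0 <= t <= 1 ->
    d (al t) (al' t) < e /\ ~ (p @` triangle a b c) (al' t).
Proof.
have [cp _ ps _ _] := pq; have [d_ge0 dE dC dD dn] := dX.
move=> cal e0; pose s := triangle a b c; pose K := p @^-1` (p @` s).
have cs : compact s by exact: triangle_compact.
have cvs : convexP s by exact: triangle_convex.
have [sa _ _] : [/\ s a, s b & s c] by exact: triangle_vertices.
have clK : closed K.
  by apply: compact_closed; [exact: rV_hausdorff|exact: (saturation_compact pq)].
have sK : s `<=` K by move=> x sx; exists x.
have c01 : compact `[0, 1 : R]%classic by exact: segment_compact.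
pose Z := al @` `[0, 1]%classic.
have cZ : compact Z by apply: continuous_compact => //; exact: continuous_subspaceT.
have [M ZM] : exists M, forall x, Z (p x) -> `|x| < M.
  have [_ _ _ pp _] := pq.
  have /compact_bounded[M [_ ZM]] := pp _ cZ.
  exists (M + 2) => x Zx; have := ZM (M + 1) _ x Zx; rewrite ltrDl => /(_ ltr01) /=.
  by move=> /le_lt_trans; apply; rewrite ltrD2l ltr1n.
have oB : open [set x : V | `|x| < M].
  apply: (open_comp (f := fun x : V => `|x|) (D := [set z | z < M])); last exact: open_lt.
  by move=> x _; exact: norm_continuous.
(* Keeps the sets [B i e2] below in a ball of radius [M], as [joined_off_saturation] requires. *)
have [|e1 e10 e1M] := compact_ball_sub dX cZ (open_inner pq oB).
  by move=> _ [t t01 <-] x /= xt; apply: ZM; rewrite xt; exists t.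
pose e2 := Num.min (e / 2) e1.
have e20 : 0 < e2 by rewrite lt_min e10 divr_gt0.
have [dl dl0 dlC] := convex_nbhs pq dX cZ e20.
(* The bound [dl / 2] puts consecutive vertices into one convex set; [e / 2] controls [al] between
   grid points. *)
pose rho := Num.min (dl / 2) (e / 2).
have rho0 : 0 < rho by rewrite lt_min !divr_gt0.
have [h h0 hrho] := uniformly_close (W := R^o) c01 cal rho0.
have [m mh] := ex_invnS_lt h0.
pose N := m.+1; pose tt i : R := i%:R / N%:R.
have NR : 0 < N%:R :> R by rewrite ltr0n.
have tt01 i : (i <= N)%N -> 0 <= tt i <= 1.
  by move=> iN; rewrite divr_ge0 //= ler_pdivrMr // mul1r ler_nat.
have Ztt i : (i <= N)%N -> Z (al (tt i)).
  by move=> /tt01 iN; exists (tt i) => //=; rewrite in_itv.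
pose B i r := [set x : V | d (al (tt i)) (p x) < r].
have oBi i r : open (B i r).
  by move/continuousP : cp => /(_ _ (@metric_ball_open (al (tt i)) r)).
have satB i r x y : p x = p y -> B i r x -> B i r y by rewrite /B /= => ->.
have BM i : (i <= N)%N -> forall x, B i e2 x -> `|x| < M.
  move=> iN x; rewrite /B /= lt_min => /andP[_ xe1].
  exact: (e1M _ (Ztt i iN) (p x) xe1 x).
have n3 : (2 < n)%N by exact: ltnW.
have Bne i : (i <= N)%N -> exists x, (B i (dl / 2) `\` K) x.
  move=> iN; apply: contrapT => /forallNP BK.
  have [x0 x0i] := ps (al (tt i)).
  have Bx0 : B i (dl / 2) x0 by rewrite /B /= x0i (proj2 (dE _ _)) // divr_gt0.
  have [y By ys] := @generic_off_triangle R n a b c _ _ n3 (@oBi i (dl / 2)) Bx0.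
  apply: (saturation_no_interior pq (@oBi i (dl / 2)) (@satB i (dl / 2)) cs cvs sa By ys).
  by move=> x Bx; apply: contrapT => Kx; apply: (BK x).
have oBK i r : open (B i r `\` K).
  by rewrite setDE; apply: openI => //; exact: closed_openC.
(* The arc is built on [[0, k]] step by step. Its vertices are chosen off [K] and closer to [al]
   than the paths between them, so that the next segment stays in [B k e2]. *)
have chain k : (k <= N)%N -> exists g : R -> V, [/\ continuous g,
    (B k (dl / 2) `\` K) (g k%:R) & forall i t, (i < k)%N -> 0 <= t <= 1 ->
     (B i e2 `\` K) (g (i%:R + t))].
  elim: k => [|k IHk] kN.
    have [x Bx] := Bne 0%N isT; exists (fun=> x); split=> //; exact: cst_continuous.
  have [g [cg [gB gK] gD]] := IHk (ltnW kN).
  have [y By] := Bne _ kN.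
  have gs : ~ s (g k%:R) by move=> /sK.
  (* The segment from the last vertex to [z] misses [s], though perhaps not [K]; a path off [K] then
     replaces it. *)
  have [z [Bz Kz] zs] := generic_segment n4 (@oBK k.+1 (dl / 2)) By gs.
  have [C [cC BC CB]] := dlC _ (Ztt k (ltnW kN)).
  have gC : C (g k%:R).
    by apply: BC; rewrite (lt_trans gB) // ltr_pdivrMr // ltr_pMr // ltr1n.
  have zC : C z.
    apply: BC; rewrite (le_lt_trans (dD _ (al (tt k.+1)) _)) // [dl]splitr ltrD //.
    apply: (@lt_le_trans _ _ rho); last by rewrite /rho ge_min lexx.
    apply: hrho; first by rewrite /= in_itv; exact: (tt01 k (ltnW kN)).
    rewrite /tt -mulrBl -natr1 opprD addNKr mulN1r normrN gtr0_norm ?invr_gt0 //.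
  have [|j [cj j0 j1 jD]] := joined_off_saturation pq (@oBi k e2) (@satB k e2)
      (BM k (ltnW kN)) cs cvs sa gK Kz.
    by move=> t t01; split; [apply: CB; exact: cC|exact: zs].
  (* Up to [k] the second summand vanishes; after [k] the two values of [g] cancel and [j]
     remains. *)
  exists (fun t => g (Num.min t k%:R) + (j (Num.max 0 (t - k%:R)) - g k%:R)); split.
  - have cid : continuous (fun t : R => t) by exact: cont_id.
    apply: contD.
      by apply: (cont_comp _ cg); apply: cont_min => //; exact: cst_continuous.
    apply: contB; last exact: cst_continuous.
    apply: (cont_comp _ cj); apply: cont_max; first exact: cst_continuous.
    by apply: contB => //; exact: cst_continuous.
  - have kk : k.+1%:R - k%:R = 1 :> R by rewrite -natr1 addrAC subrr add0r.
    by rewrite min_r ?ler_nat // kk max_r ?ler01 // j1 subrKC.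
  - move=> i t; rewrite ltnS leq_eqVlt => /predU1P[->|ik] t01.
      rewrite min_r ?lerDl ?[k%:R + t - _]addrAC ?subrr ?add0r ?max_r ?subrKC //; try by case/andP: t01.
      exact: jD.
    have itk : i%:R + t <= k%:R.
      have : (i.+1%:R : R) <= k%:R by rewrite ler_nat.
      by rewrite -natr1; lra.
    rewrite min_l // max_l ?subr_le0 // j0 subrr addr0.
    exact: gD.
have [g [cg _ gD]] := chain N (leqnn N).
exists (p \o (fun t => g (N%:R * t))); split.
  apply: (cont_comp _ cp); apply: (cont_comp _ cg).
  by apply: contM; [exact: cst_continuous|exact: cont_id].
move=> t t01; have [//|i iN [u u01 Nt]] := @grid_index N t _ t01.
rewrite /= Nt; have [gB gK] := gD i u iN u01; split; last exact: gK.
rewrite (le_lt_trans (dD _ (al (tt i)) _)) // [e]splitr ltrD //; last first.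
  by rewrite (lt_le_trans gB) // /e2 ge_min lexx.
apply: (@lt_le_trans _ _ rho); last by rewrite /rho ge_min lexx orbT.
apply: hrho; first by rewrite /= in_itv.
have -> : t - tt i = u / N%:R.
  by rewrite /tt -[t](mulKf (lt0r_neq0 NR)) Nt; field; rewrite gt_eqF.
case/andP: u01 => u0 u1; rewrite ger0_norm ?divr_ge0 ?(ltW NR) //.
by rewrite (le_lt_trans _ mh) // ler_piMl ?invr_ge0 ?(ltW NR).
Qed.

(** Triangles already avoided have compact saturations, so the arc stays off them if the next push
    is small enough. *)
Lemma push_arc_off_triangles (ts : seq (V * V * V)) (al : R -> X) (e : R) :
  continuous al -> 0 < e ->
  exists al' : R -> X, continuous al' /\ forall t, 0 <= t <= 1 ->
    d (al t) (al' t) < e /\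
    forall abc, abc \in ts -> ~ (p @` triangle abc.1.1 abc.1.2 abc.2) (al' t).
Proof.
have [cp pO ps _ _] := pq; have [d_ge0 dE dC dD dn] := dX.
elim: ts al e => [|abc ts IHts] al e cal e0.
  by exists al; split=> // t t01; rewrite (proj2 (dE _ _)).
have [al1 [cal1 al1P]] := IHts _ _ cal (divr_gt0 e0 (ltr0Sn R 1)).
pose U := [set w | forall abc, abc \in ts -> ~ (p @` triangle abc.1.1 abc.1.2 abc.2) w].
have oU : open U.
  rewrite (_ : U = ~` (\bigcup_(i in [set` ts]) (p @` triangle i.1.1 i.1.2 i.2))).
    apply: closed_openC; apply: closed_bigcup; first exact: finite_seq.
    move=> i _; rewrite -openC; apply: pO; apply: closed_openC.
    apply: compact_closed; first exact: rV_hausdorff.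
    by apply: (saturation_compact pq); exact: triangle_compact.
  apply/seteqP; split=> [w Uw [i /= its wi]|w Uw i its wi]; first exact: (Uw i).
  by apply: Uw; exists i.
have c01 : compact `[0, 1 : R]%classic by exact: segment_compact.
have [||h h0 hU] := @compact_ball_sub R X d dX (al1 @` `[0, 1]%classic) U _ oU.
- by apply: continuous_compact => //; exact: continuous_subspaceT.
- by move=> _ [t /= t01 <-]; apply: (proj2 (al1P t _)); move: t01; rewrite in_itv.
have e'0 : 0 < Num.min h (e / 2) by rewrite lt_min h0 divr_gt0.
have [al' [cal' al'P]] := push_arc_off_triangle abc.1.1 abc.1.2 abc.2 cal1 e'0.
exists al'; split=> // t t01; have [dt nt] := al'P t t01; have [d1 _] := al1P t t01.
move: dt; rewrite lt_min => /andP[dh de]; split.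
  by rewrite (le_lt_trans (dD _ (al1 t) _)) // [e]splitr ltrD.
move=> i; rewrite inE => /predU1P[->//|its].
by apply: (hU (al1 t) _ (al' t)) => //=; exists t => //; rewrite /= in_itv.
Qed.

End arc_pushing.

(** * Piecewise affine approximation on the disk *)

(** With [g] a retraction onto [A], this extends [f] to a continuous total map. *)
Lemma continuous_comp_within (S T U : topologicalType) (A : set T) (f : T -> U) (g : S -> T) :
  {within A, continuous f} -> continuous g -> (forall x, A (g x)) -> continuous (f \o g).
Proof.
move=> /subspace_continuousP cf cg Ag x B /(cf (g x) (Ag x)) fB.
have cgB : nbhs x (g @^-1` [set y | A y -> B (f y)]) by apply: (cg x); exact: fB.
suff : nbhs x ((f \o g) @^-1` B) by [].
by apply: filterS cgB => y; apply; exact: Ag.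
Qed.

Section hat_function.
Variable R : realType.
Implicit Types (u v y : R) (i j k l : nat).

(* The vertex function of the triangulation of the plane into the unit squares
   of the integer grid, each cut along the diagonal of direction (1, 1). *)
Definition hat u v : R := Num.max 0 (1 - Num.max (Num.max `|u| `|v|) `|u - v|).

Lemma hat_ge0 u v : 0 <= hat u v.
Proof. by rewrite le_max lexx. Qed.

Lemma hat_neq0 u v : (hat u v != 0) = [&& `|u| < 1, `|v| < 1 & `|u - v| < 1].
Proof.
rewrite andbA -!gt_max /hat; set w := Num.max _ `|u - v|.
have [w1|w1] := ltP w 1; last by rewrite max_l ?eqxx ?subr_le0.
by rewrite max_r ?gt_eqF ?subr_gt0 // subr_ge0 ltW.
Qed.

Lemma nat_near_truncn y k : 0 <= y -> `|y - k%:R| < 1 ->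
  k = Num.truncn y \/ k = (Num.truncn y).+1.
Proof.
move=> /truncn_itv/andP[iy yi] yk; set i := Num.truncn y in iy yi *.
have ki : (k < i.+2)%N.
  by rewrite -(ltr_nat R) -[i.+2%:R]natr1; move: yk; rewrite ltr_norml; lra.
have ik : (i < k.+1)%N.
  by rewrite -(ltr_nat R) -[k.+1%:R]natr1; move: yk; rewrite ltr_norml; lra.
by clear -ki ik; clearbody i; lia.
Qed.

Lemma hat_truncn y y' : 0 <= y -> 0 <= y' ->
  hat (y - (Num.truncn y)%:R) (y' - (Num.truncn y')%:R) != 0.
Proof.
move=> /truncn_itv/andP[iy yi] /truncn_itv/andP[iy' yi'].
move: yi yi'; rewrite -!natr1 => yi yi'.
by rewrite hat_neq0 !ltr_norml; apply/and3P; split; apply/andP; split; lra.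
Qed.

(** The comparison of the fractional parts tells on which side of the diagonal the point lies; the
    corner across the diagonal then has weight zero. *)
Lemma hat_support y y' : 0 <= y -> 0 <= y' ->
  let i := Num.truncn y in let j := Num.truncn y' in
  (forall k l, hat (y - k%:R) (y' - l%:R) != 0 ->
     (k, l) \in [:: (i, j); (i.+1, j); (i.+1, j.+1)]) \/
  (forall k l, hat (y - k%:R) (y' - l%:R) != 0 ->
     (k, l) \in [:: (i, j); (i, j.+1); (i.+1, j.+1)]).
Proof.
move=> y0 y'0 i j.
have [yy|yy] := leP (y' - j%:R) (y - i%:R); [left|right] => k l;
  rewrite hat_neq0 => /and3P[yk yl ykl];
  have := nat_near_truncn y0 yk; have := nat_near_truncn y'0 yl;
  rewrite -/i -/j => -[] le [] ke; rewrite ke le !inE ?eqxx ?orbT //;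
  by exfalso; move: ykl; rewrite ke le -natr1 ltr_norml; lra.
Qed.

End hat_function.

Section disk_approximation.
Variables (R : realType) (n : nat) (X : topologicalType) (p : 'rV[R]_n -> X).
Hypothesis pq : convex_quotient p.
Variable d : X -> X -> R.
Hypothesis dX : compatible_metric d.
Local Notation V := 'rV[R]_n.

(** Values of [F] at grid points are lifted to R^n and averaged with hat weights. The lifts used at
    [x] lie in a convex set over a small ball at [F x], and they are vertices of one triangle of the
    list. *)
Lemma approximate_square (F : R * R -> X) (e : R) : continuous F -> 0 < e ->
  exists (g : R * R -> V) (ts : seq (V * V * V)), continuous g /\
    forall x, -1 <= x.1 <= 1 -> -1 <= x.2 <= 1 -> d (F x) (p (g x)) < e /\
      exists2 abc, abc \in ts & triangle abc.1.1 abc.1.2 abc.2 (g x).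
Proof.
have [cp _ ps _ _] := pq; have [d_ge0 dE dC dD dn] := dX.
move=> cF e0.
have cI : compact `[-1, 1 : R]%classic by exact: segment_compact.
have cQ := compact_setX cI cI.
have cFQ : compact (F @` (`[-1, 1]%classic `*` `[-1, 1]%classic)).
  by apply: continuous_compact => //; exact: continuous_subspaceT.
have [dl dl0 dlC] := convex_nbhs pq dX cFQ e0.
have [h h0 hdl] := uniformly_close dX (W := (R^o * R^o)%type) cQ cF dl0.
have [m mh] := ex_invnS_lt (divr_gt0 h0 (ltr0Sn R 1)).
pose N := m.+1; have NR : 0 < N%:R :> R by rewrite ltr0n.
pose P i : R := 2 * (i%:R / N%:R) - 1.
have /choice[q qP] (ij : nat * nat) : exists x, p x = F (P ij.1, P ij.2) by exact: ps.
(* The grid coordinate: [[-1, 1]] is stretched to [[0, N]], and points outside are clamped. *)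
pose Y (t : R) := N%:R * Num.max 0 (Num.min 1 ((1 + t) / 2)).
have cY : continuous Y.
  apply: contM; first exact: cst_continuous.
  apply: cont_max; first exact: cst_continuous.
  apply: cont_min; first exact: cst_continuous.
  apply: contM; last exact: cst_continuous.
  by apply: (@contD R R R^o); [exact: cst_continuous|exact: cont_id].
have Y0N t : 0 <= Y t <= N%:R.
  apply/andP; split; first by apply: mulr_ge0; [exact: ltW|rewrite le_max lexx].
  by apply: ler_piMr; [exact: ltW|rewrite ge_max ler01 ge_min lexx].
have YE t : -1 <= t <= 1 -> Y t = N%:R * ((1 + t) / 2).
  by move=> t1; rewrite /Y min_r ?max_r //; lra.
pose idx := [seq (i, j) | i <- iota 0 N.+1, j <- iota 0 N.+1].
have mem_idx i j : ((i, j) \in idx) = (i <= N)%N && (j <= N)%N.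
  rewrite /idx; apply/allpairsP/andP => [[[i' j'] [iI jI [-> ->]]]|[iN jN]].
    by move: iI jI; rewrite !mem_iota.
  by exists (i, j); split=> //; rewrite mem_iota.
pose w (x : R * R) (ij : nat * nat) := hat (Y x.1 - ij.1%:R) (Y x.2 - ij.2%:R).
have c1 : continuous (fun uv : R * R => uv.1) by move=> ?; exact: cvg_fst.
have c2 : continuous (fun uv : R * R => uv.2) by move=> ?; exact: cvg_snd.
have cw ij : continuous (w^~ ij).
  have cu : continuous (fun x : R * R => Y x.1 - ij.1%:R).
    by apply: (@contB R _ R^o); [exact: (cont_comp c1 cY)|exact: cst_continuous].
  have cv : continuous (fun x : R * R => Y x.2 - ij.2%:R).
    by apply: (@contB R _ R^o); [exact: (cont_comp c2 cY)|exact: cst_continuous].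
  apply: cont_max; first exact: cst_continuous.
  apply: (@contB R _ R^o); first exact: cst_continuous.
  apply: cont_max; last by apply: (@cont_norm R _ R^o); exact: (@contB R _ R^o).
  by apply: cont_max; apply: (@cont_norm R _ R^o).
have w_ge0 x ij : 0 <= w x ij by exact: hat_ge0.
have truncY t : (Num.truncn (Y t) <= N)%N.
  have /andP[Y0 YN] := Y0N t.
  by rewrite -(ler_nat R) (le_trans _ YN) //; case/andP: (truncn_itv Y0).
have S_gt0 x : 0 < \sum_(ij <- idx) w x ij.
  rewrite lt_neqAle sumr_ge0 // andbT eq_sym psumr_eq0 //; apply/negP => /allP.
  move=> /(_ (Num.truncn (Y x.1), Num.truncn (Y x.2))); rewrite mem_idx !truncY.
  move=> /(_ isT); apply/negP; apply: hat_truncn.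
    by case/andP: (Y0N x.1).
  by case/andP: (Y0N x.2).
(* Both halves of each grid square. As [Y] reaches [N], squares whose lower corner has an index [N]
   are included; [q] is defined beyond the grid too. *)
pose ts := [seq (q ij, q (ij.1.+1, ij.2), q (ij.1.+1, ij.2.+1)) | ij <- idx] ++
           [seq (q ij, q (ij.1, ij.2.+1), q (ij.1.+1, ij.2.+1)) | ij <- idx].
exists (fun x => (\sum_(ij <- idx) w x ij)^-1 *: (\sum_(ij <- idx) w x ij *: q ij)), ts.
split=> [|x x1 x2].
  apply: contZ.
    by apply: contV => [x|]; [rewrite gt_eqF|exact: (@cont_sum R _ R^o)].
  by apply: cont_sum => ij; apply: contZ => //; exact: cst_continuous.
have Qx : (`[-1, 1]%classic `*` `[-1, 1]%classic) x by split; rewrite /= in_itv.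
split.
  have [C [cC BC CB]] := dlC _ (imageP F Qx).
  apply: CB; apply: weighted_mean_in => // ij.
  rewrite hat_neq0 !YE // => /and3P[xi xj _].
  apply: BC; rewrite qP; apply: (hdl x) => //.
  have close t i : `|N%:R * ((1 + t) / 2) - i%:R| < 1 -> `|t - P i| < h.
    move=> ti; have -> : t - P i = 2 / N%:R * (N%:R * ((1 + t) / 2) - i%:R).
      by rewrite /P; field; rewrite gt_eqF.
    rewrite normrM gtr0_norm ?divr_gt0 //.
    have Nh : 2 / N%:R < h by rewrite mulrC -ltr_pdivlMr.
    by apply: le_lt_trans Nh; apply: ler_piMr; rewrite ltW // divr_gt0.
  by rewrite [ltLHS]/Num.norm /= gt_max !close.
have /andP[Y1 _] := Y0N x.1; have /andP[Y2 _] := Y0N x.2.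
set i := Num.truncn (Y x.1); set j := Num.truncn (Y x.2).
have ijN : (i, j) \in idx by rewrite mem_idx !truncY.
case: (hat_support Y1 Y2); rewrite -/i -/j => wij.
  exists (q (i, j), q (i.+1, j), q (i.+1, j.+1)).
    by rewrite mem_cat; apply/orP; left; apply/mapP; exists (i, j).
  have [t1 t2 t3] := triangle_vertices (q (i, j)) (q (i.+1, j)) (q (i.+1, j.+1)).
  apply: weighted_mean_in => //; first exact: triangle_convex.
  by move=> [k l] /wij; rewrite !inE => /or3P[] /eqP ->.
exists (q (i, j), q (i, j.+1), q (i.+1, j.+1)).
  by rewrite mem_cat; apply/orP; right; apply/mapP; exists (i, j).
have [t1 t2 t3] := triangle_vertices (q (i, j)) (q (i, j.+1)) (q (i.+1, j.+1)).
apply: weighted_mean_in => //; first exact: triangle_convex.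
by move=> [k l] /wij; rewrite !inE => /or3P[] /eqP ->.
Qed.

End disk_approximation.

(** * The theorem *)

Lemma disk_retraction (R : realType) : exists r : R * R -> R * R,
  [/\ continuous r, forall x, unit_disk (r x) & forall x, unit_disk x -> r x = x].
Proof.
pose N (x : R * R) : R := Num.max 1 (Num.sqrt (x.1 ^+ 2 + x.2 ^+ 2)).
have c1 : continuous (fun x : R * R => x.1) by move=> ?; exact: cvg_fst.
have c2 : continuous (fun x : R * R => x.2) by move=> ?; exact: cvg_snd.
have N0 x : 0 < N x by rewrite lt_max ltr01.
have cN : continuous N.
  apply: cont_max; first exact: cst_continuous.
  have cs : continuous (fun x : R * R => x.1 * x.1 + x.2 * x.2).
    by apply: (@contD R _ R^o); exact: contM.
  exact: (cont_comp cs (@sqrt_continuous R)).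
have cNV : continuous (fun x => (N x)^-1) by apply: contV => // x; rewrite gt_eqF.
exists (fun x => ((N x)^-1 * x.1, (N x)^-1 * x.2)); split=> [x|x|x].
- exact: cont_pair (contM cNV c1) (contM cNV c2) x.
- rewrite /unit_disk /= !exprMn -mulrDr exprVn mulrC ler_pdivrMr ?exprn_gt0 // mul1r.
  have S0 : 0 <= x.1 ^+ 2 + x.2 ^+ 2 by rewrite addr_ge0 // sqr_ge0.
  rewrite -[leLHS]sqr_sqrtr // ler_sqr ?nnegrE ?sqrtr_ge0 ?(ltW (N0 x)) //.
  by rewrite le_max lexx orbT.
- move=> dx; have -> : N x = 1.
    rewrite /N max_l // -sqrtr1 ler_sqrt //; exact: dx.
  by rewrite invr1 !mul1r; case: x dx.
Qed.

Lemma decomposition_convex_quotient (R : realType) n (G : decomposition 'rV[R]_n) :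
  upper_semicontinuous G ->
  (forall g : set 'rV[R]_n, elements G g -> convex_set g) ->
  convex_quotient (@decomposition_map 'rV[R]_n G).
Proof.
move=> [_ pG] cG; pose V := 'rV[R]_n.
have fibE (x y : V) : decomposition_map G y = decomposition_map G x <->
    sval (decomposition_map G x : decomposition_elements G) y.
  split=> [<-|yx]; first exact: decomposition_piP.
  have [_ tG _] := elements_partition G.
  apply: eq_sig_hprop => [h|]; first exact: Prop_irrelevance.
  apply: tG; [exact: svalP|exact: svalP|].
  by exists y; split=> //; exact: decomposition_piP.
split=> // [|z|x y z t xz yz t01].
- exact: pi_continuous.
- by exists (repr z); rewrite /decomposition_map reprK.
move/fibE: xz => xz; move/fibE: yz => yz; apply/fibE.
case/andP: t01 => t0 t1.
have /(_ y x (Itv01 t0 t1)) := cG _ (svalP (decomposition_map G z : decomposition_elements G)).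
rewrite !inE => /(_ yz xz).
suff -> : x + t *: (y - x) = t *: y + (1 - t) *: x by [].
by apply/rowP => i; rewrite !mxE; ring.
Qed.

Theorem theorem3p2 (R : realType) (n : nat) (G : decomposition 'rV[R]_n) :
  (4 <= n)%N ->
  upper_semicontinuous G ->
  (forall g : set 'rV[R]_n, elements G g -> convex_set g) ->
  disjoint_arc_disk_property R (decomposition_space G).
Proof.
move=> n4 uG cG; have pq := decomposition_convex_quotient uG cG.
set p := @decomposition_map _ G in pq.
split=> [|d dX a f e ca cf e0]; first exact: (convex_quotient_metrizable pq).
(* Retractions onto the interval and the disk make both maps total and continuous without changing
   the values that matter. *)
pose clamp (t : R) := Num.max 0 (Num.min 1 t).
have cclamp : continuous clamp.
  apply: cont_max; first exact: cst_continuous.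
  by apply: cont_min; [exact: cst_continuous|exact: cont_id].
have clamp01 t : `[0, 1]%classic (clamp t).
  by rewrite /= in_itv /= /clamp le_max lexx ge_max ler01 ge_min lexx.
have clampE t : 0 <= t <= 1 -> clamp t = t.
  by move=> /andP[t0 t1]; rewrite /clamp min_r ?max_r.
have [r [cr rD rE]] := disk_retraction R.
have [g [ts [cg gP]]] :=
  approximate_square pq dX (continuous_comp_within cf cr rD) e0.
have [a' [ca' a'P]] :=
  push_arc_off_triangles pq n4 dX ts (continuous_comp_within ca cclamp clamp01) e0.
have disk_square (x : R * R) : unit_disk x -> -1 <= x.1 <= 1 /\ -1 <= x.2 <= 1.
  rewrite /unit_disk /= => x1; have := sqr_ge0 x.1; have := sqr_ge0 x.2.
  by move: x1; rewrite !expr2; split; apply/andP; split; nra.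
exists a', (p \o g); split.
- exact: continuous_subspaceT.
- by apply: continuous_subspaceT; apply: (cont_comp cg); case: pq.
- move=> t; rewrite in_itv /= => t01; have [+ _] := a'P t t01.
  by rewrite /= clampE.
- move=> x dx; have [x1 x2] := disk_square x dx; have [+ _] := gP x x1 x2.
  by rewrite /= rE.
(* A common point would lie in the image of a triangle of [ts], which the new arc avoids. *)
rewrite -subset0 => w [[t /= t01 <-] [x dx gx]].
have [x1 x2] := disk_square x dx; have [_ [abc its gabc]] := gP x x1 x2.
rewrite in_itv /= in t01; have [_ nt] := a'P t t01.
by apply: (nt abc its); exists (g x).
Qed.
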